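(* Let $(R,\mathfrak{m})$ be a Noetherian local ring and let $M$ and $N$ be two finitely generated maximal Cohen--Macaulay $R$-modules, having multiplicities $m$ and $n$ respectively. Assume that there are only finitely many isomorphism classes of maximal Cohen--Macaulay $R$-modules of multiplicity $m+n$. If $h$ is the number of such isomorphism classes, then $\mathfrak{m}^h$ annihilates $\operatorname{Ext}^1_R(M,N)$. In particular, $\operatorname{Ext}^1_R(M,N)$ has finite length.
   Context: A finitely generated module $M$ over a Noetherian local ring $R$ is maximal Cohen--Macaulay (MCM) if $\operatorname{depth} M=\dim R$. Multiplicity means the Hilbert--Samuel multiplicity with respect to $\mathfrak{m}$. The ring $R$ itself is not assumed to be Cohen--Macaulay. Modules counted among the isomorphism classes are not assumed indecomposable. *)

(* Defs.v *)
From HB Require Import structures.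
From mathcomp Require Import all_boot all_order all_algebra.
From mathcomp Require Import generic_quotient ring_quotient.
From mathcomp Require Import boolp classical_sets functions.
From mathcomp Require Import topology normedtype sequences.

Set Implicit Arguments.
Unset Strict Implicit.
Unset Printing Implicit Defensive.

Import Order.TTheory GRing.Theory Num.Theory.
Import numFieldNormedType.Exports.

Local Open Scope classical_set_scope.
Local Open Scope ring_scope.
Local Open Scope quotient_scope.

(* Submodules are boolean predicates, as everywhere in ssralg; in the presence *)
(* of `[< _ >] this is no restriction.  Ideals of R that need not be proper    *)
(* are submodules of R^o; proper and prime ideals are the idealr and           *)
(* prime_idealr of ring_quotient.                                              *)
Record submod (R : pzRingType) (M : lmodType R) := Submod {
  submod_pred :> {pred M};
  submod_predP : submod_closed submod_pred
}.

HB.instance Definition _ (R : pzRingType) (M : lmodType R) (A : submod M) :=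
  GRing.isSubmodClosed.Build R M (submod_pred A)
    (GRing.submod_closed_semi (submod_predP A)).

Definition subm_type (R : pzRingType) (M : lmodType R) (A : submod M) : Type :=
  {x : M | x \in submod_pred A}.

Section SubmoduleType.
Variables (R : pzRingType) (M : lmodType R) (A : submod M).
HB.instance Definition _ := SubChoice.on (subm_type A).
HB.instance Definition _ :=
  [SubChoice_isSubLmodule of subm_type A by <:].
End SubmoduleType.

(* ring_quotient provides the underlying abelian group of M / A. *)
Definition quotm (R : pzRingType) (M : lmodType R) (A : submod M) : Type :=
  Quotient.quot (submod_pred A).

Section QuotientModule.
Variables (R : pzRingType) (M : lmodType R) (A : submod M).
Local Notation Q := (quotm A).

HB.instance Definition _ := GRing.Zmodule.on Q.

Definition quotm_pi (x : M) : Q := \pi_(Quotient.quot (submod_pred A)) x.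

Lemma quotm_piP (x y : M) : reflect (quotm_pi x = quotm_pi y) (x - y \in A).
Proof. by rewrite Quotient.idealrBE; apply: eqP. Qed.

Lemma quotm_piD (x y : M) : quotm_pi (x + y) = quotm_pi x + quotm_pi y.
Proof. exact: Quotient.pi_add. Qed.

Lemma quotm_pi_surj (q : Q) : exists x, q = quotm_pi x.
Proof. by exists (repr q); rewrite /quotm_pi reprK. Qed.

Definition quotm_scale (a : R) (q : Q) : Q :=
  quotm_pi (a *: repr (q : Quotient.quot (submod_pred A))).

Lemma quotm_piZ (a : R) (x : M) :
  quotm_pi (a *: x) = quotm_scale a (quotm_pi x).
Proof.
apply/quotm_piP; rewrite -scalerBr; apply: rpredZ.
by apply/quotm_piP; rewrite /quotm_pi reprK.
Qed.

Lemma quotm_scalerA a b q :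
  quotm_scale a (quotm_scale b q) = quotm_scale (a * b) q.
Proof. by have [x ->] := quotm_pi_surj q; rewrite -!quotm_piZ scalerA. Qed.

Lemma quotm_scale1r : left_id 1 quotm_scale.
Proof.
by move=> q; have [x ->] := quotm_pi_surj q; rewrite -quotm_piZ scale1r.
Qed.

Lemma quotm_scalerDr : right_distributive quotm_scale +%R.
Proof.
move=> a p q; have [x ->] := quotm_pi_surj p; have [y ->] := quotm_pi_surj q.
by rewrite -quotm_piD -!quotm_piZ -quotm_piD scalerDr.
Qed.

Lemma quotm_scalerDl q : {morph quotm_scale^~ q : a b / a + b}.
Proof.
move=> a b /=; have [x ->] := quotm_pi_surj q.
by rewrite -!quotm_piZ -quotm_piD scalerDl.
Qed.

HB.instance Definition _ := GRing.Zmodule_isLmodule.Build R Q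
  quotm_scalerA quotm_scale1r quotm_scalerDr quotm_scalerDl.

Lemma quotm_pi_is_linear : linear quotm_pi.
Proof. by move=> a x y; rewrite quotm_piD quotm_piZ. Qed.

HB.instance Definition _ := GRing.isLinear.Build R M Q _ quotm_pi
  quotm_pi_is_linear.

End QuotientModule.

Section Submodules.
Variables (R : comNzRingType) (M : lmodType R).

Lemma fullm_subproof : @submod_closed R M predT.
Proof. by []. Qed.

Definition fullm : submod M := Submod fullm_subproof.

Variables (I : {pred R}) (A : submod M).

Definition mulm_pred : {pred M} := [pred y | `[< exists k (a : 'I_k -> R)
  (x : 'I_k -> M), (forall i, a i \in I /\ x i \in A) /\
    y = \sum_(i < k) a i *: x i >]].

Lemma mulm_subproof : submod_closed mulm_pred.
Proof.
split=> [|c y z].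
  rewrite inE; exists 0%N, (fun=> 0), (fun=> 0).
  by split=> [[]|]; rewrite ?big_ord0.
rewrite !inE => -[k [a [x [axP ->]]]] [l [b [w [bwP ->]]]].
exists (k + l)%N.
exists (fun i : 'I_(k + l) => match fintype.split i with inl j => a j | inr j => b j end).
exists (fun i : 'I_(k + l) => match fintype.split i with inl j => c *: x j | inr j => w j end).
split=> [i|].
  by case: (fintype.split i) => j; [have [? ?] := axP j | have [? ?] := bwP j];
    split=> //; exact: rpredZ.
rewrite big_split_ord /= scaler_sumr; congr (_ + _); apply: eq_bigr => i _.
  by rewrite (unsplitK (inl i)) !scalerA mulrC.
by rewrite (unsplitK (inr i)).
Qed.

(* I A, also for a set I of scalars that is not an ideal: since A is a         *)
(* submodule, it then equals (I) A.                                            *)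
Definition mulm : submod M := Submod mulm_subproof.

End Submodules.

Arguments fullm {R} M.

Definition ideal_pow (R : comNzRingType) (I : {pred R}) (n : nat) :
    submod (R^o : lmodType R) :=
  iter n (mulm I) (fullm _).

Section Finiteness.
Variable R : comNzRingType.

Definition fin_gen (M : lmodType R) : Prop :=
  exists k (x : 'I_k -> M), forall y,
    exists c : 'I_k -> R, y = \sum_(i < k) c i *: x i.

Definition is_max (P : nat -> Prop) (n : nat) : Prop :=
  P n /\ forall k, P k -> (k <= n)%N.

Definition proper_sub (T : eqType) (A B : {pred T}) : Prop :=
  {subset A <= B} /\ ~ {subset B <= A}.

Definition has_length (M : lmodType R) : nat -> Prop :=
  is_max (fun n => exists C : nat -> submod M,
    forall i, (i < n)%N -> proper_sub (C i) (C i.+1)).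

Definition finite_length (M : lmodType R) : Prop := exists n, has_length M n.

End Finiteness.

Section LocalRing.
Variable R : comNzRingType.

Definition noetherian : Prop :=
  forall I : submod (R^o : lmodType R), fin_gen (subm_type I).

Definition maximal_ideal (I : idealr R) : Prop :=
  forall J : idealr R, {subset I <= J} -> {subset J <= I}.

Definition local_ring (mx : idealr R) : Prop :=
  maximal_ideal mx /\ forall J, maximal_ideal J -> J =i mx.

Definition krull_dim : nat -> Prop :=
  is_max (fun n => exists p : nat -> prime_idealr R,
    forall i, (i < n)%N -> proper_sub (p i) (p i.+1)).

Definition modulo (M : lmodType R) (xs : seq R) : lmodType R :=
  quotm (mulm [in xs] (fullm M)).

Definition regular_seq (M : lmodType R) (xs : seq R) : Prop :=
  (forall i, (i < size xs)%N ->
     forall y : modulo M (take i xs), xs`_i *: y = 0 -> y = 0) /\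
  exists y : modulo M xs, y != 0.

Variable mx : idealr R.

(* The zero module has no regular sequence (not even the empty one), hence no  *)
(* depth in this sense; this matches the convention that its depth is infinite.*)
Definition has_depth (M : lmodType R) : nat -> Prop :=
  is_max (fun n => exists xs : seq R,
    [/\ size xs = n, {subset xs <= mx} & regular_seq M xs]).

Definition is_MCM (M : lmodType R) : Prop :=
  fin_gen M /\ exists d, krull_dim d /\ has_depth M d.

(* e(M) = lim d! length(M / m^k M) / k^d with d = dim R, which is also dim M   *)
(* when M is MCM.  rat^o is rat with the topology of the absolute value.       *)
Definition has_multiplicity (M : lmodType R) (e : nat) : Prop :=
  exists (d : nat) (l : nat -> nat),
    [/\ krull_dim d,
        forall k, has_length (quotm (mulm (ideal_pow mx k) (fullm M))) (l k) &
        (fun k => (d`! * l k)%:R / (k ^ d)%:R : rat^o) @ \oo -->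
          (e%:R : rat^o)].

End LocalRing.

Section IsoClasses.
Variable R : comNzRingType.

Definition isomorphic (M N : lmodType R) : Prop :=
  exists f : {linear M -> N}, bijective f.

Definition num_iso_classes (P : lmodType R -> Prop) (h : nat) : Prop :=
  exists K : 'I_h -> lmodType R,
    [/\ forall i, P (K i),
        forall i j, isomorphic (K i) (K j) -> i = j &
        forall L, P L -> exists i, isomorphic L (K i)].

End IsoClasses.

Section Ext.
Variable R : comNzRingType.

Definition projective (P : lmodType R) : Prop :=
  forall (A B : lmodType R) (g : {linear A -> B}) (f : {linear P -> B}),
    (forall b, exists a, g a = b) -> exists f' : {linear P -> A}, g \o f' =1 f.

Record proj_resolution (M : lmodType R) := ProjResolution {
  res_obj :> nat -> lmodType R;
  res_diff : forall i, {linear res_obj i.+1 -> res_obj i};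
  res_aug : {linear res_obj 0 -> M};
  res_proj : forall i, projective (res_obj i);
  res_aug_surj : forall y, exists x, res_aug x = y;
  res_exact0 : forall x, res_aug x = 0 <-> exists z, x = res_diff 0 z;
  res_exactS : forall i x, res_diff i x = 0 <-> exists z, x = res_diff i.+1 z
}.

Variables (M : lmodType R) (P : proj_resolution M) (N : lmodType R).

Definition cocycle1_pred : {pred (P 1 -> N)} := [pred f | `[< linear f /\
  forall z, f (res_diff P 1 z) = 0 >]].

Lemma cocycle1_subproof : submod_closed cocycle1_pred.
Proof.
split=> [|c f g].
  by rewrite inE; split=> // a u v; rewrite -[RHS]/(a *: 0 + 0) scaler0 addr0.
rewrite !inE => -[lf f0] [lg g0]; split=> [a u v|z].
  rewrite -[LHS]/(c *: f _ + g _) -[RHS]/(a *: (c *: f u + g u) + _).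
  rewrite lf lg !scalerDr !scalerA mulrC -!addrA; congr (_ + _).
  by rewrite addrCA.
by rewrite -[LHS]/(c *: f _ + g _) f0 g0 scaler0 addr0.
Qed.

Definition cocycle1 : submod (P 1 -> N) := Submod cocycle1_subproof.

Definition coboundary1_pred : {pred (subm_type cocycle1)} :=
  [pred f | `[< exists g : {linear P 0 -> N}, val f = g \o res_diff P 0 >]].

Lemma coboundary1_subproof : submod_closed coboundary1_pred.
Proof.
split=> [|c f g].
  by rewrite inE; exists (\0 : {linear P 0 -> N}).
rewrite !inE => -[u fu] [v gv];
exists ((c \*: u) \+ v : {linear P 0 -> N}).
by rewrite raddfD /= fu gv.
Qed.

Definition coboundary1 : submod (subm_type cocycle1) :=
  Submod coboundary1_subproof.

(* H^1 of the complex Hom(P, N), for a projective resolution P of M. *)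
Definition Ext1 : lmodType R := quotm coboundary1.

End Ext.

(* Main.v *)
(** A class in Ext^1(M, N) is given by a linear map g to N from the kernel of a
    free presentation F -> M, and its pushout E_g is an extension of M by N,
    hence MCM (depth) of multiplicity m + n (Artin-Rees).  For r_1, ..., r_h in
    the maximal ideal, two of the h + 1 modules E_{r_1 ... r_j g} are therefore
    isomorphic, so it suffices that E_g ~ E_sg with s in the maximal ideal forces
    g to extend to F.  This is a variant of Miyata's theorem: comparing the
    lengths of Hom(E_g, T) and Hom(E_sg, T) for T = N / m^k N shows that g
    extends modulo m^k N for every k, and one concludes by Krull's intersection
    theorem, in N^l modulo the values of linear maps F -> N at l generators of
    the kernel. *)
From HB Require Import structures.
From mathcomp Require Import all_boot all_order all_algebra.
From mathcomp Require Import ring_quotient.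
From mathcomp Require Import boolp classical_sets functions.
From mathcomp Require Import topology normedtype sequences.
Require Import Defs.

Set Implicit Arguments.
Unset Strict Implicit.
Unset Printing Implicit Defensive.

Import Order.TTheory GRing.Theory Num.Theory.
Import numFieldNormedType.Exports.

Local Open Scope ring_scope.

(** An isomorphism between [E_g] and [E_sg] need not respect the copies of N or the maps to M, so
    only numerical information can be drawn from it. Hence the comparison of lengths, and hence the
    target N / m^k N instead of N: lengths cancel only when they are finite, and here the
    multiplicity hypothesis on N supplies them. The price is a separate extension of g for each k,
    with no compatibility between them.

    The exponent h is a pigeonhole count over the h + 1 prefixes of a product of h elements, the
    empty prefix included. A coincidence shows that the shorter of the two prefixes already kills
    the class, hence so does the whole product.

    The resolution that defines Ext is arbitrary and its terms need not be finitely generated.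
    Cocycles are therefore moved to the kernel of a finite free cover of M, which has finitely many
    generators. This also makes Ext finitely generated, so that annihilation by m^h gives finite
    length. *)

Section MakeSubmod.
Variables (R : comNzRingType) (M : lmodType R).
Implicit Types A B : submod M.

Lemma submod_eq A B : A =i B -> A = B.
Proof.
case: A B => [A hA] [B hB] e.
have eAB : A = B by apply: funext => x; exact: e.
by rewrite eAB in hA e *; congr Submod; exact: Prop_irrelevance.
Qed.

Lemma submod_anti A B : {subset A <= B} -> {subset B <= A} -> A = B.
Proof.
by move=> AB BA; apply: submod_eq => x; apply/idP/idP; [exact: AB|exact: BA].
Qed.

Variables (P : M -> Prop) (P0 : P 0)
  (PZD : forall c x y, P x -> P y -> P (c *: x + y)).

Lemma mksub_subproof : submod_closed [pred x | `[< P x >]].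
Proof.
split=> [|c x y]; first by apply/asboolP.
by move=> /asboolP Px /asboolP Py; apply/asboolP; exact: PZD.
Qed.

Definition mksub : submod M := Submod mksub_subproof.

Lemma mksubP x : reflect (P x) (x \in mksub).
Proof. exact: asboolP. Qed.

End MakeSubmod.

(** * Operations on submodules, spans and finite generation *)

Section Constructions.
Variables (R : comNzRingType) (M : lmodType R).
Implicit Types (A B : submod M) (x y : M) (s : seq M).

Lemma zerom0 : (0 : M) = 0. Proof. by []. Qed.
Lemma zeromZD (c : R) x y : x = 0 -> y = 0 -> c *: x + y = 0.
Proof. by move=> -> ->; rewrite scaler0 addr0. Qed.
Definition zerom : submod M := mksub zerom0 zeromZD.
Lemma zeromP x : reflect (x = 0) (x \in zerom). Proof. exact: mksubP. Qed.

Lemma addm0 A B : exists2 a, a \in A & 0 - a \in B.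
Proof. by exists 0; rewrite ?subr0 rpred0. Qed.
Lemma addmZD A B (c : R) x y : (exists2 a, a \in A & x - a \in B) ->
  (exists2 a, a \in A & y - a \in B) ->
  exists2 a, a \in A & c *: x + y - a \in B.
Proof.
move=> [a aA xB] [b bA yB]; exists (c *: a + b).
  by rewrite rpredD ?rpredZ.
by rewrite opprD addrACA -scalerBr rpredD ?rpredZ.
Qed.
Definition addm A B : submod M := mksub (@addm0 A B) (@addmZD A B).
Lemma addmP A B x : reflect (exists2 a, a \in A & x - a \in B) (x \in addm A B).
Proof. exact: mksubP. Qed.
Lemma addml A B : {subset A <= addm A B}.
Proof. by move=> x xA; apply/addmP; exists x; rewrite ?subrr ?rpred0. Qed.
Lemma addmr A B : {subset B <= addm A B}.
Proof. by move=> x xA; apply/addmP; exists 0; rewrite ?subr0 ?rpred0. Qed.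

Lemma capm0 A B : 0 \in A /\ 0 \in B.
Proof. by rewrite !rpred0. Qed.
Lemma capmZD A B (c : R) x y : x \in A /\ x \in B -> y \in A /\ y \in B ->
  c *: x + y \in A /\ c *: x + y \in B.
Proof. by move=> [xA xB] [yA yB]; rewrite !rpredD ?rpredZ. Qed.
Definition capm A B : submod M := mksub (@capm0 A B) (@capmZD A B).
Lemma capmP A B x : reflect (x \in A /\ x \in B) (x \in capm A B).
Proof. exact: mksubP. Qed.

Lemma consm0 (a : R) A : exists z, 0 - a *: z \in A.
Proof. by exists 0; rewrite scaler0 subr0 rpred0. Qed.
Lemma consmZD (a : R) A (c : R) x y : (exists z, x - a *: z \in A) ->
  (exists z, y - a *: z \in A) -> exists z, c *: x + y - a *: z \in A.
Proof.
move=> [z xA] [w yA]; exists (c *: z + w).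
rewrite scalerDr opprD addrACA scalerA mulrC -scalerA -scalerBr.
by rewrite rpredD ?rpredZ.
Qed.
(** The submodule A + aM. Dividing M / A by one more element becomes a change of A with M fixed,
    which is how regular sequences are handled. *)
Definition consm (a : R) A : submod M := mksub (@consm0 a A) (@consmZD a A).
Lemma consmP a A x : reflect (exists z, x - a *: z \in A) (x \in consm a A).
Proof. exact: mksubP. Qed.
Lemma consm_sub a A : {subset A <= consm a A}.
Proof. by move=> x xA; apply/consmP; exists 0; rewrite scaler0 subr0. Qed.
Lemma consm_scale a A x : a *: x \in consm a A.
Proof. by apply/consmP; exists x; rewrite subrr rpred0. Qed.

Lemma adjoin0 x A : exists c : R, 0 - c *: x \in A.
Proof. by exists 0; rewrite scale0r subr0 rpred0. Qed.
Lemma adjoinZD x A (c : R) y z : (exists c : R, y - c *: x \in A) ->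
  (exists c : R, z - c *: x \in A) -> exists d : R, c *: y + z - d *: x \in A.
Proof.
move=> [d yA] [e zA]; exists (c * d + e).
by rewrite scalerDl opprD addrACA -scalerA -scalerBr rpredD ?rpredZ.
Qed.
Definition adjoin x A : submod M := mksub (@adjoin0 x A) (@adjoinZD x A).
Lemma adjoinP x A y : reflect (exists c, y - c *: x \in A) (y \in adjoin x A).
Proof. exact: mksubP. Qed.
Lemma adjoin_sub x A : {subset A <= adjoin x A}.
Proof. by move=> y yA; apply/adjoinP; exists 0; rewrite scale0r subr0. Qed.
Lemma adjoin_mem x A : x \in adjoin x A.
Proof. by apply/adjoinP; exists 1; rewrite scale1r subrr rpred0. Qed.

Definition span s : submod M := foldr adjoin zerom s.

Lemma mem_span s : {subset s <= span s}.
Proof.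
elim: s => // x s IH y; rewrite inE => /orP[/eqP->|/IH]; first exact: adjoin_mem.
exact: adjoin_sub.
Qed.

Lemma span_sub s A : {subset s <= A} -> {subset span s <= A}.
Proof.
elim: s => [|x s IH] sA y; first by move=> /zeromP->; rewrite rpred0.
move=> /adjoinP[c /IH ycA]; rewrite -(subrK (c *: x) y) rpredD //.
  by apply: ycA => z zs; rewrite sA // inE zs orbT.
by rewrite rpredZ // sA // mem_head.
Qed.

Lemma span_mono s1 s2 : {subset s1 <= s2} -> {subset span s1 <= span s2}.
Proof. by move=> s12; apply: span_sub => x /s12; exact: mem_span. Qed.

Lemma span_sum s y : y \in span s ->
  exists c : 'I_(size s) -> R, y = \sum_(i < size s) c i *: s`_i.
Proof.
elim: s y => [|x s IH] y.
  by move=> /zeromP->; exists (fun=> 0); rewrite big_ord0.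
move=> /adjoinP[c /IH[d yE]].
exists (fun i => if unlift ord0 i is Some j then d j else c).
rewrite big_ord_recl unlift_none /=; under eq_bigr do rewrite liftK.
by rewrite -yE addrC subrK.
Qed.

Definition fg A : Prop := exists s, A = span s.

Lemma fin_genP : fin_gen M <-> fg (fullm M).
Proof.
split=> [[k [x xP]]|[s sE]].
  exists [seq x i | i <- enum 'I_k]; apply: submod_anti => // y _.
  have [c ->] := xP y; apply: rpred_sum => i _; apply: rpredZ.
  by apply: mem_span; rewrite map_f // mem_enum.
exists (size s), (fun i => s`_i) => y.
have : y \in span s by rewrite -sE.
exact: span_sum.
Qed.

End Constructions.
Arguments zerom {R} M.

Definition submv (R : comNzRingType) (M : lmodType R) (A : submod M) :
  {linear subm_type A -> M} := val.

Section MapSubmod.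
Variables (R : comNzRingType) (M N : lmodType R) (f : {linear M -> N}).

Lemma mapm0 (A : submod M) : exists2 x, x \in A & 0 = f x.
Proof. by exists 0; rewrite ?rpred0 ?linear0. Qed.
Lemma mapmZD (A : submod M) (c : R) x y : (exists2 z, z \in A & x = f z) ->
  (exists2 z, z \in A & y = f z) -> exists2 z, z \in A & c *: x + y = f z.
Proof.
move=> [z zA ->] [w wA ->]; exists (c *: z + w); last by rewrite linearP.
by rewrite rpredD ?rpredZ.
Qed.
Definition mapm A : submod N := mksub (@mapm0 A) (@mapmZD A).
Lemma mapmP (A : submod M) y : reflect (exists2 x, x \in A & y = f x) (y \in mapm A).
Proof. exact: mksubP. Qed.
Lemma mem_mapm (A : submod M) x : x \in A -> f x \in mapm A.
Proof. by move=> xA; apply/mapmP; exists x. Qed.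

Lemma comapm0 (A : submod N) : f 0 \in A.
Proof. by rewrite linear0 rpred0. Qed.
Lemma comapmZD (A : submod N) (c : R) x y : f x \in A -> f y \in A ->
  f (c *: x + y) \in A.
Proof. by move=> xA yA; rewrite linearP rpredD ?rpredZ. Qed.
Definition comapm (A : submod N) : submod M :=
  mksub (@comapm0 A) (@comapmZD A).
Lemma comapmE (A : submod N) x : (x \in comapm A) = (f x \in A).
Proof. by apply/mksubP/idP. Qed.

Lemma mapm_span s : mapm (span s) = span (map f s).
Proof.
apply: submod_anti => y.
  move=> /mapmP[x xs ->].
  have : {subset span s <= comapm (span (map f s))}.
    apply: span_sub => z zs; rewrite comapmE mem_span //; exact: map_f.
  by move=> /(_ _ xs); rewrite comapmE.
apply: span_sub => _ /mapP[x xs ->]; exact/mem_mapm/mem_span.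
Qed.

Lemma fg_full_surj : (forall y, exists x, f x = y) ->
  fg (fullm M) -> fg (fullm N).
Proof.
move=> fsurj [s sE]; exists (map f s); rewrite -mapm_span -sE.
by apply: submod_anti => // y _; have [x <-] := fsurj y; apply: mem_mapm.
Qed.

End MapSubmod.

(** * Noetherian modules *)

Section Noetherian.
Variable R : comNzRingType.

Definition noeth_mod (M : lmodType R) := forall A : submod M, fg A.

Lemma noetherian_noeth_mod : noetherian R -> noeth_mod R^o.
Proof.
move=> nR I; have [k [x xP]] := nR I.
exists [seq val (x i) | i <- enum 'I_k]; apply: submod_anti => y.
  move=> yI; have [c] := xP (Sub y yI); move=> /(congr1 (submv I)); rewrite linear_sum => yE.
  rewrite -[y]/(submv I (Sub y yI)) yE; apply: rpred_sum => i _.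
  rewrite linearZ /=; apply: rpredZ.
  by apply: mem_span; apply/mapP; exists i; rewrite ?mem_enum.
by apply: span_sub => _ /mapP[i _ ->]; exact: valP.
Qed.

(** Without a maximal member, choice gives a strictly increasing sequence. Its union is a submodule
    whose finitely many generators already lie in one term, which leaves no room for the next. *)
Lemma noeth_max (M : lmodType R) (P : submod M -> Prop) :
  noeth_mod M -> (exists A, P A) ->
  exists A, P A /\ forall B, P B -> {subset A <= B} -> B = A.
Proof.
move=> nM [A0 PA0]; apply: contrapT => nmax.
have step (A : {A | P A}) : exists B : {A | P A},
    {subset sval A <= sval B} /\ ~ {subset sval B <= sval A}.
  apply: contrapT => nB; apply: nmax; exists (sval A); split; first exact: svalP.
  move=> B PB AB; apply: contrapT => neq; apply: nB.
  by exists (exist _ B PB); split=> //= BA; apply: neq; apply: submod_anti.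
have [f fP] := choice step.
pose C n : submod M := sval (iter n f (exist _ A0 PA0)).
have Cmono n k : {subset C n <= C (n + k)%N}.
  elim: k => [|k IH]; first by rewrite addn0.
  by move=> x /IH; rewrite addnS; exact: (fP _).1.
have U0 : exists n, 0 \in C n by exists 0%N; rewrite rpred0.
have UZD (c : R) x y : (exists n, x \in C n) -> (exists n, y \in C n) ->
    exists n, c *: x + y \in C n.
  move=> [n xn] [k yk]; exists (n + k)%N.
  by rewrite rpredD ?rpredZ //; [exact: Cmono|rewrite addnC; exact: Cmono].
have [s sE] := nM (mksub U0 UZD).
have [n sn] : exists n, {subset s <= C n}.
  have : {subset s <= mksub U0 UZD} by rewrite sE; exact: mem_span.
  elim: s {sE} => [|x s IH] sU; first by exists 0%N.
  have [k xk] : exists k, x \in C k by apply/(mksubP U0 UZD)/sU/mem_head.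
  have [l sl] : exists n, {subset s <= C n}.
    by apply: IH => y ys; apply: sU; rewrite inE ys orbT.
  exists (k + l)%N => y; rewrite inE => /orP[/eqP->|ys]; first exact: Cmono.
  by rewrite addnC; apply/Cmono/sl.
apply: (fP (iter n f (exist _ A0 PA0))).2 => x xn.
have xU : x \in mksub U0 UZD by apply/mksubP; exists n.+1.
by rewrite sE in xU; exact: span_sub xU.
Qed.

Lemma fg_sub_span (M : lmodType R) (s : seq M) (A : submod M) :
  noeth_mod R^o -> {subset A <= span s} -> fg A.
Proof.
move=> nR; elim: s A => [|x s IH] A sA.
  by exists [::]; apply: submod_anti => // y /zeromP->; rewrite rpred0.
(* The ideal of the coefficients that [x] takes in elements of A, read modulo [span s]. *)
have J0 : exists2 a, a \in A & a - (0 : R^o) *: x \in span s.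
  by exists 0; rewrite ?rpred0 // scale0r subr0 rpred0.
have JZD (c : R) (d e : R^o) : (exists2 a, a \in A & a - d *: x \in span s) ->
    (exists2 a, a \in A & a - e *: x \in span s) ->
    exists2 a, a \in A & a - (c *: d + e) *: x \in span s.
  move=> [a aA ha] [b bA hb]; exists (c *: a + b).
    by rewrite rpredD ?rpredZ.
  by rewrite scalerDl opprD addrACA -scalerA -scalerBr rpredD ?rpredZ.
have [t tE] := nR (mksub J0 JZD).
(* The generators of that ideal are lifted to elements of A. A generator outside the ideal would
   make the implication vacuous, so [[::]] serves there. *)
have [u uA tu] : exists2 u, {subset u <= A} &
    {subset t <= mksub J0 JZD} ->
    forall d, d \in span t -> exists2 a, a \in span u & a - d *: x \in span s.
  elim: t {tE} => [|d t IHt].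
    exists [::] => // _ d /zeromP->; exists 0; rewrite ?rpred0 //.
    by rewrite scale0r subr0 rpred0.
  have [u uA tu] := IHt.
  have [dJ|dJ] := pselect (d \in mksub J0 JZD); last first.
    by exists [::] => // /(_ d (mem_head _ _)).
  have /mksubP[a aA ha] := dJ.
  exists (a :: u) => [b|tJ e].
    by rewrite inE => /orP[/eqP->|/uA].
  move=> /adjoinP[c]; have tJ' : {subset t <= mksub J0 JZD}.
    by move=> z zt; apply: tJ; rewrite inE zt orbT.
  move=> /(tu tJ')[b bu hb]; exists (c *: a + b).
    by apply/adjoinP; exists c; rewrite addrAC subrr add0r.
  have -> : c *: a + b - e *: x
      = c *: (a - d *: x) + (b - (e - c *: d) *: x).
    by rewrite scalerBr scalerBl opprB scalerA addrACA addKr.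
  by rewrite rpredD ?rpredZ.
(* Subtracting the lifts from an element of A leaves a rest in [span s], where the induction
   hypothesis applies. *)
have [v vE] : fg (capm A (span s)).
  by apply: IH => y /capmP[].
exists (u ++ v); apply: submod_anti; last first.
  apply: span_sub => y; rewrite mem_cat => /orP[/uA //|yv].
  have : y \in span v by exact: mem_span.
  by rewrite -vE => /capmP[].
move=> y yA; have /adjoinP[c yc] := sA y yA.
have cJ : c \in span t by rewrite -tE; apply/(mksubP J0 JZD); exists y.
have tJ : {subset t <= mksub J0 JZD}.
  by move=> z zt; rewrite tE; exact: mem_span.
have [a au ha] := tu tJ c cJ.
have aA : a \in A by exact: span_sub au.
rewrite -(subrK a y) rpredD //; last first.
  by apply: (span_mono _ au) => z zu; rewrite mem_cat zu.
have : y - a \in capm A (span s).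
  apply/capmP; split; first by rewrite rpredB.
  have -> : y - a = (y - c *: x) - (a - c *: x).
    by rewrite opprB addrA subrK.
  by rewrite rpredB.
rewrite vE; apply: span_mono => z zv; by rewrite mem_cat zv orbT.
Qed.

Lemma noeth_fg_mod (M : lmodType R) : noeth_mod R^o -> fg (fullm M) ->
  noeth_mod M.
Proof.
by move=> nR [s sE] A; apply: (fg_sub_span (s := s)) => // x _; rewrite -sE.
Qed.

End Noetherian.

Section MkLin.
Variables (R : comNzRingType) (M N : lmodType R).
Definition mklin (f : M -> N) (Hf : linear f) : {linear M -> N} :=
  HB.pack f (GRing.isLinear.Build R M N *:%R f Hf).
Lemma mklinE (f : M -> N) (Hf : linear f) x : mklin Hf x = f x.
Proof. by []. Qed.
End MkLin.

Lemma submv_inj (R : comNzRingType) (M : lmodType R) (A : submod M) :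
  injective (submv A).
Proof. exact: val_inj. Qed.

Lemma submvP (R : comNzRingType) (M : lmodType R) (A : submod M) x :
  submv A x \in A.
Proof. exact: valP. Qed.

Lemma corestrict (R : comNzRingType) (M N : lmodType R) (f : {linear M -> N})
    (A : submod N) : (forall x, f x \in A) ->
  exists g : {linear M -> subm_type A}, forall x, submv A (g x) = f x.
Proof.
move=> fA.
have gl : linear (fun x => Sub (f x) (fA x) : subm_type A).
  by move=> c x y; apply: (@submv_inj _ _ A); rewrite [RHS]linearP /= [LHS]linearP.
by exists (mklin gl).
Qed.

Lemma is_max_uniq (P : nat -> Prop) n k : is_max P n -> is_max P k -> n = k.
Proof.
by move=> [Pn nP] [Pk kP]; apply/eqP; rewrite eqn_leq kP // nP.
Qed.

Lemma is_max_bounded (P : nat -> Prop) b : P 0%N ->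
  (forall k, P k -> (k <= b)%N) -> exists n, is_max P n.
Proof.
move=> P0 Pb.
have exP : exists k, `[< P k >] by exists 0%N; apply/asboolP.
have leP k : `[< P k >] -> (k <= b)%N by move=> /asboolP; exact: Pb.
case: (ex_maxnP exP leP) => n /asboolP Pn nmax; exists n; split=> // k Pk.
by apply: nmax; apply/asboolP.
Qed.

(** * Length *)

Section RelativeLength.
Variable R : comNzRingType.
Implicit Types M N K : lmodType R.

Definition chain_to M (A X : submod M) n := exists C : nat -> submod M,
  [/\ {subset A <= C 0%N}, C n = X &
      forall i, (i < n)%N -> proper_sub (C i) (C i.+1)].

Definition rchain M (A : submod M) n := exists X, chain_to A X n.

(* The length of M / A, read off from submodules of M. *)
Definition rlen M (A : submod M) n := is_max (rchain A) n.

Lemma chain_to_sub M (A X : submod M) n : chain_to A X n -> {subset A <= X}.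
Proof.
move=> [C [A0 <- Cn]].
elim: n Cn => // n IH Cn x xA; apply: (Cn n _).1 => //.
by apply: IH => // i ni; exact/Cn/ltnW.
Qed.

Lemma chain_toS M (A X Y : submod M) n :
  chain_to A X n -> proper_sub X Y -> chain_to A Y n.+1.
Proof.
move=> [C [A0 Cn Cp]] XY.
exists (fun i => if (i <= n)%N then C i else Y); split=> //; first by rewrite ltnn.
move=> i; rewrite ltnS leq_eqVlt => /orP[/eqP->|ni].
  by rewrite eqxx ltnn Cn.
by rewrite ni orbT; exact: Cp.
Qed.

Lemma chain_to0 M (A X : submod M) : {subset A <= X} -> chain_to A X 0.
Proof. by move=> AX; exists (fun=> X). Qed.

Lemma chain_to_weak M (A X Y : submod M) n : chain_to A X n ->
  {subset X <= Y} -> exists2 k, (n <= k)%N & chain_to A Y k.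
Proof.
move=> AX XY; have [YX|YX] := pselect {subset Y <= X}.
  by exists n => //; rewrite (submod_anti YX XY).
by exists n.+1 => //; exact: chain_toS AX _.
Qed.

Lemma rchain0 M (A : submod M) : rchain A 0.
Proof. by exists A; apply: chain_to0. Qed.

Lemma chain_to_split M (A X : submod M) n : chain_to A X n.+1 ->
  exists2 Y, chain_to A Y n & proper_sub Y X.
Proof.
move=> [C [A0 <- Cp]]; exists (C n); last exact: Cp.
by exists C; split=> // i ni; apply/Cp/ltnW.
Qed.

Lemma chain_to_trans M (A X : submod M) n : chain_to A X n ->
  forall Y k, chain_to X Y k -> chain_to A Y (n + k).
Proof.
move=> AX Y k; elim: k Y => [|k IH] Y.
  (* A chain of zero steps only says that X lies in Y, so the last strict step of the first chain is
     stretched to end at Y. *)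
  move=> /chain_to_sub XY; have [k'] := chain_to_weak AX XY.
  rewrite addn0; move=> _; have [C [A0 Cn Cp]] := AX => _.
  case: n AX Cn Cp => [|n] AX Cn Cp; first by apply: chain_to0 => x /A0; rewrite Cn => /XY.
  have [Z AZ [ZX XZ]] := chain_to_split AX.
  by apply: chain_toS AZ _; split=> [x /ZX/XY|YZ] //; apply: XZ => x /XY/YZ.
by move=> /chain_to_split[Z XZ ZY]; rewrite addnS; apply: chain_toS ZY; exact: IH.
Qed.

Lemma rlen_bounded M (A : submod M) b : (forall n, rchain A n -> (n <= b)%N) ->
  exists n, rlen A n.
Proof. by move=> h; apply: is_max_bounded h; exact: rchain0. Qed.

Section Exact.
Variables (N K M : lmodType R) (i : {linear N -> K}) (p : {linear K -> M}).
Hypothesis psurj : forall y, exists x, p x = y.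
Hypothesis ip_exact : forall x, p x = 0 <-> exists n, x = i n.

(** A chain in N is carried to the submodules i(X) + C and continued by preimages of a chain in M.
    The two can be joined because the former stay below the preimage of p(C). *)
Lemma rchain_exact_ge (C : submod K) a b :
  rchain (comapm i C) a -> rchain (mapm p C) b -> rchain C (a + b).
Proof.
move=> [X] AX [Y DY].
have CX : exists2 X', chain_to C X' a & X' = addm (mapm i X) C.
  elim: a X AX => [|a IH] X AX.
    by eexists; [|reflexivity]; apply: chain_to0; exact: addmr.
  have [Z AZ [ZX XZ]] := chain_to_split AX.
  have [X' CX' X'E] := IH _ AZ.
  exists (addm (mapm i X) C) => //; apply: chain_toS CX' _; rewrite X'E; split.
    move=> x /addmP[y /mapmP[z /ZX zX ->] xC].
    by apply/addmP; exists (i z) => //; exact: mem_mapm.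
  move=> XsZ; apply: XZ => x xX.
  have : i x \in addm (mapm i X) C by apply: addml; exact: mem_mapm.
  move=> /XsZ/addmP[_ /mapmP[z zZ ->]]; rewrite -linearB -comapmE => xzA.
  by rewrite -(subrK z x) rpredD //; exact: chain_to_sub AZ _ xzA.
have CY : chain_to (comapm p (mapm p C)) (comapm p Y) b.
  elim: b Y DY => [|b IH] Y DY.
    by apply: chain_to0 => x; rewrite !comapmE; exact: (chain_to_sub DY).
  have [Z AZ [ZY YZ]] := chain_to_split DY.
  apply: chain_toS (IH _ AZ) _; split=> [x|YsZ]; first by rewrite !comapmE => /ZY.
  apply: YZ => y; have [x <-] := psurj y; rewrite -!comapmE; exact: YsZ.
have [X' CX' X'E] := CX.
exists (comapm p Y); apply: (chain_to_trans CX').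
have X'p : {subset X' <= comapm p (mapm p C)}.
  rewrite X'E => x /addmP[y /mapmP[z _ ->] xC]; rewrite comapmE.
  have -> : p x = p (x - i z).
    by rewrite linearB (_ : p (i z) = 0) ?subr0 //; apply/ip_exact; exists z.
  exact: mem_mapm.
by rewrite -(add0n b); apply: (chain_to_trans (chain_to0 X'p)).
Qed.

(** By the modular law a strict inclusion in K stays strict after restriction to N or after
    projection to M, so every step is counted on at least one side. *)
Lemma rchain_exact_le (C : submod K) n : rchain C n ->
  exists a b, [/\ rchain (comapm i C) a, rchain (mapm p C) b & (n <= a + b)%N].
Proof.
move=> [X CX].
suff [a [b [h1 h2 nab]]] : exists a b,
    [/\ chain_to (comapm i C) (comapm i X) a,
        chain_to (mapm p C) (mapm p X) b & (n <= a + b)%N].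
  by exists a, b; split=> //; [exists (comapm i X)|exists (mapm p X)].
elim: n X CX => [|n IH] X CX.
  have CsX := chain_to_sub CX.
  exists 0%N, 0%N; split=> //; apply: chain_to0 => x.
    by rewrite !comapmE => /CsX.
  by move=> /mapmP[y /CsX yX ->]; exact: mem_mapm.
have [Y CY [YX XY]] := chain_to_split CX.
have [a [b [ha hb nab]]] := IH _ CY.
have iYX : {subset comapm i Y <= comapm i X} by move=> x; rewrite !comapmE => /YX.
have pYX : {subset mapm p Y <= mapm p X}.
  by move=> _ /mapmP[y /YX yX ->]; exact: mem_mapm.
have [pXY|pXY] := pselect {subset mapm p X <= mapm p Y}; last first.
  have [a' aa' ha'] := chain_to_weak ha iYX.
  exists a', b.+1; split=> //; first exact: chain_toS hb _.
  by rewrite addnS ltnS (leq_trans nab) // leq_add2r.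
have [b' bb' hb'] := chain_to_weak hb pYX.
exists a.+1, b'; split=> //; last first.
  by rewrite addSn ltnS (leq_trans nab) // leq_add2l.
apply: chain_toS ha _; split=> // iXY; apply: XY => x xX.
have /pXY/mapmP[z zY pxz] : p x \in mapm p X by exact: mem_mapm.
have [|w xzw] := (ip_exact (x - z)).1; first by rewrite linearB pxz subrr.
rewrite -(subrK z x) rpredD // xzw -comapmE; apply: iXY.
by rewrite comapmE -xzw rpredB // YX.
Qed.

Lemma rlen_exact (C : submod K) a b :
  rlen (comapm i C) a -> rlen (mapm p C) b -> rlen C (a + b).
Proof.
move=> [ha amax] [hb bmax]; split; first exact: rchain_exact_ge.
move=> k /rchain_exact_le[a' [b' [/amax ha' /bmax hb' kab]]].
by rewrite (leq_trans kab) // leq_add.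
Qed.

Lemma rlen_exact_inv (C : submod K) n : rlen C n ->
  exists a b, [/\ rlen (comapm i C) a, rlen (mapm p C) b & n = (a + b)%N].
Proof.
move=> hn; have [_ nmax] := hn.
have [a ha] : exists a, rlen (comapm i C) a.
  apply: (@rlen_bounded _ _ n) => k hk; rewrite -(addn0 k).
  exact/nmax/rchain_exact_ge/rchain0.
have [b hb] : exists b, rlen (mapm p C) b.
  apply: (@rlen_bounded _ _ n) => k hk; rewrite -(add0n k).
  exact/nmax/rchain_exact_ge/hk/rchain0.
by exists a, b; split=> //; exact: is_max_uniq hn (rlen_exact ha hb).
Qed.

End Exact.

(** Additivity along the kernel of [f]: it lies in the preimage of D, so it contributes length 0. *)
Lemma rlen_surj M N (f : {linear M -> N}) (D : submod N) n :
  (forall y, exists x, f x = y) -> rlen (comapm f D) n <-> rlen D n.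
Proof.
move=> fsurj.
have e (x : M) : f x = 0 <-> exists z : subm_type (comapm f (zerom N)), x = submv _ z.
  split=> [fx0|[z ->]]; last by have := valP z; rewrite comapmE => /zeromP.
  have xk : x \in comapm f (zerom N) by rewrite comapmE; apply/zeromP.
  by exists (Sub x xk).
have mf : mapm f (comapm f D) = D.
  apply: submod_anti => y; first by move=> /mapmP[x]; rewrite comapmE => xD ->.
  by have [x <-] := fsurj y; move=> xD; apply: mem_mapm; rewrite comapmE.
have cf : comapm (submv (comapm f (zerom N))) (comapm f D) = fullm _.
  apply: submod_anti => // z _; rewrite !comapmE.
  by have := valP z; rewrite comapmE => /zeromP/= ->; rewrite rpred0.
have l0 : rlen (comapm (submv (comapm f (zerom N))) (comapm f D)) 0.
  rewrite cf; split=> [|k [X [C [C0 _ Cp]]]]; first exact: rchain0.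
  by case: k Cp => // k /(_ 0%N isT)[_ []] x _; exact: C0.
split=> [hn|hn].
  have [a [b [ha hb ->]]] := rlen_exact_inv fsurj e hn.
  by rewrite (is_max_uniq ha l0) add0n -mf.
by rewrite -(add0n n); apply: (rlen_exact fsurj e) => //; rewrite mf.
Qed.

Lemma has_length_rlen M n : has_length M n <-> rlen (zerom M) n.
Proof.
have e k : (exists C : nat -> submod M,
    forall i, (i < k)%N -> proper_sub (C i) (C i.+1)) <-> rchain (zerom M) k.
  split=> [[C CP]|[X [C [_ _ CP]]]]; last by exists C.
  by exists (C k), C; split=> // x /zeromP->; rewrite rpred0.
by split=> -[h1 h2]; (split; first exact/e); move=> k /e/h2.
Qed.

Lemma quotm_pi_eq0 M (A : submod M) x : (quotm_pi A x = 0) <-> (x \in A).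
Proof.
rewrite -(linear0 (quotm_pi A)) -[in x \in A](subr0 x).
by split=> /quotm_piP.
Qed.

Lemma quotm_surj M (A : submod M) (y : quotm A) : exists x, quotm_pi A x = y.
Proof. by have [x ->] := quotm_pi_surj y; exists x. Qed.

Lemma comapm_pi M (A : submod M) : comapm (quotm_pi A) (zerom _) = A.
Proof.
apply: submod_anti => x; rewrite comapmE; first by move=> /zeromP/quotm_pi_eq0.
by move=> /quotm_pi_eq0/zeromP.
Qed.

Lemma has_length_quotm M (A : submod M) n : has_length (quotm A) n <-> rlen A n.
Proof.
rewrite has_length_rlen -[in rlen A n](comapm_pi A).
by symmetry; apply: rlen_surj; exact: quotm_surj.
Qed.

Definition short_exact N K M (i : {linear N -> K}) (p : {linear K -> M}) :=
  [/\ injective i, forall y, exists x, p x = y &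
      forall x, p x = 0 <-> exists n, x = i n].

Lemma short_exact_sub M (A : submod M) : short_exact (submv A) (quotm_pi A).
Proof.
split; [exact: val_inj|exact: quotm_surj|] => x.
rewrite quotm_pi_eq0; split=> [xA|[z ->]]; last exact: valP.
by exists (Sub x xA).
Qed.

Lemma comapm_zero N K (i : {linear N -> K}) : injective i ->
  comapm i (zerom K) = zerom N.
Proof.
move=> ij; apply: submod_anti => x; rewrite comapmE => /zeromP x0; apply/zeromP.
  by apply: ij; rewrite x0 linear0.
by rewrite x0 linear0.
Qed.

Lemma mapm_zero N K (i : {linear N -> K}) : mapm i (zerom N) = zerom K.
Proof.
apply: submod_anti => x; first by move=> /mapmP[_ /zeromP-> ->]; rewrite linear0 rpred0.
by move=> /zeromP->; rewrite rpred0.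
Qed.

Lemma has_length_exact N K M (i : {linear N -> K}) (p : {linear K -> M}) a b :
  short_exact i p -> has_length N a -> has_length M b -> has_length K (a + b).
Proof.
move=> [ij ps ip]; rewrite !has_length_rlen => ha hb.
by apply: (rlen_exact ps ip); rewrite ?comapm_zero ?mapm_zero.
Qed.

Lemma has_length_exact_inv N K M (i : {linear N -> K}) (p : {linear K -> M}) n :
  short_exact i p -> has_length K n ->
  exists a b, [/\ has_length N a, has_length M b & n = (a + b)%N].
Proof.
move=> [ij ps ip]; rewrite has_length_rlen => /(rlen_exact_inv ps ip).
rewrite comapm_zero // mapm_zero => -[a [b [ha hb e]]].
by exists a, b; split=> //; exact/has_length_rlen.
Qed.

Lemma finite_length_exact N K M (i : {linear N -> K}) (p : {linear K -> M}) :
  short_exact i p -> finite_length N -> finite_length M -> finite_length K.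
Proof. by move=> ip [a ha] [b hb]; exists (a + b)%N; exact: has_length_exact ip _ _. Qed.

Lemma finite_length_sub M (A : submod M) : finite_length M ->
  finite_length (subm_type A).
Proof.
by move=> [n /(has_length_exact_inv (short_exact_sub A))[a [b [ha _ _]]]]; exists a.
Qed.

Lemma has_length_bij M N (f : {linear M -> N}) n : bijective f ->
  has_length M n -> has_length N n.
Proof.
move=> [g fK gK] /has_length_rlen hn; apply/has_length_rlen.
have fs y : exists x, f x = y by exists (g y); rewrite gK.
by apply/(rlen_surj _ _ fs); rewrite comapm_zero //; exact: can_inj fK.
Qed.

Lemma finite_length_inj M N (f : {linear M -> N}) : injective f ->
  finite_length N -> finite_length M.
Proof.
move=> fi hN; pose A := mapm f (fullm M).
have [n hn] := finite_length_sub A hN.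
have fA x : f x \in A by exact: mem_mapm.
have [g gE] := corestrict fA.
have gs y : exists x, g x = y.
  have /mapmP[x _ xE] := submvP y; exists x; apply: submv_inj.
  by rewrite gE.
have gi : injective g by move=> x y /(congr1 (submv A)); rewrite !gE => /fi.
have [h gK hK] : bijective g.
  have [h hP] := choice gs; exists h => // x; exact/gi.
exists n.
have hl : linear h by move=> c x y; apply: gi; rewrite linearP !hK.
by apply: (has_length_bij (f := mklin hl)) hn; exists g.
Qed.

(** By additivity the inclusion has a cokernel of length 0, whereas a missing element would give
    that cokernel a chain of one step. *)
Lemma has_length_subset M (A B : submod M) n : {subset A <= B} ->
  has_length (subm_type A) n -> has_length (subm_type B) n -> {subset B <= A}.
Proof.
move=> AB hA hB.
have sAB (x : subm_type A) : submv A x \in B by exact/AB/submvP.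
have [g gE] := corestrict sAB.
pose D := mapm (g) (fullm _).
have ex : short_exact (g) (quotm_pi D).
  split; [|exact: quotm_surj|] => x.
    by move=> y /(congr1 (submv B)); rewrite !gE => /submv_inj.
  rewrite quotm_pi_eq0; split=> [/mapmP[z _ ->]|[z ->]]; first by exists z.
  exact: mem_mapm.
have [a [b [ha hb nab]]] := has_length_exact_inv ex hB.
have b0 : b = 0%N.
  by apply/eqP; rewrite -(eqn_add2l n) addn0 -{1}(is_max_uniq ha hA) -nab.
move: hb; rewrite b0 => /has_length_quotm[_ D0] x xB.
have [xD|xD] := pselect ((Sub x xB : subm_type B) \in D).
  by have /mapmP[z _ /(congr1 (submv B))] := xD; rewrite gE /= => ->; exact: submvP.
have /D0 // : rchain D 1.
  exists (fullm _); apply: chain_toS (chain_to0 (X := D) _) _ => //.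
  by split=> // /(_ (Sub x xB) isT).
Qed.

Lemma short_exact_pow_cons M k : exists (i : {linear M -> ('I_k.+1 -> M)})
  (p : {linear ('I_k.+1 -> M) -> ('I_k -> M)}), short_exact i p.
Proof.
pose iF (x : M) : 'I_k.+1 -> M := fun j => if j == ord0 then x else 0.
have il : linear iF.
  move=> c x y; apply: funext => j; rewrite /iF !fctE.
  by case: eqP => _ //; rewrite scaler0 addr0.
pose pF (f : 'I_k.+1 -> M) : 'I_k -> M := fun j => f (lift ord0 j).
have pl : linear pF by move=> c x y; apply: funext => j.
exists (mklin il), (mklin pl); split=> [x y /(congr1 (fun f => f ord0))|y|x].
- by rewrite /= /iF eqxx.
- exists (fun j => if unlift ord0 j is Some i then y i else 0).
  by apply: funext => j; rewrite /= /pF liftK.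
- split=> [x0|[n ->]]; last by apply: funext => j.
  exists (x ord0); apply: funext => j; rewrite /= /iF; case: eqP => [->//|].
  move=> /eqP; case: (unliftP ord0 j) => [j' ->|->]; last by rewrite eqxx.
  by move=> _; have := congr1 (fun f => f j') x0.
Qed.

Lemma finite_length_pow M k : finite_length M -> finite_length ('I_k -> M).
Proof.
move=> hM; elim: k => [|k IH]; last first.
  by have [i [p ip]] := short_exact_pow_cons M k; exact: finite_length_exact ip _ _.
exists 0%N; apply/has_length_rlen; split; first exact: rchain0.
move=> [|k] // [X [C [_ _ /(_ 0%N isT)[_ []]]]] x _.
suff -> : x = 0 by rewrite rpred0.
by apply: funext => -[].
Qed.

End RelativeLength.

(** * Local rings and Nakayama's lemma *)

Lemma submod_mull (R : comNzRingType) (I : submod (R^o : lmodType R)) (a x : R) :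
  x \in I -> a * x \in I.
Proof. exact: (@rpredZ R R^o I a x). Qed.

Lemma scale_is_linear (R : comNzRingType) (M : lmodType R) (a : R) :
  linear (fun x : M => a *: x).
Proof. by move=> c u v; rewrite scalerDr !scalerA mulrC. Qed.

Lemma submod_idealr_closed (R : comNzRingType) (I : submod (R^o : lmodType R)) :
  1 \notin I -> idealr_closed (I : {pred R}).
Proof.
move=> I1; split=> // [|a u v uI vI]; first exact: (rpred0 I).
exact: (@rpredD _ I (a * u : R^o) v (submod_mull a uI) vI).
Qed.

(* Written out because [mulm (ideal_pow mx k) A] elaborates over the ring R^o,
   as it does in has_multiplicity; the two agree only up to the opaque proof
   that they are submodules, see mulm_ideal_pow. *)
Definition powm (R : comNzRingType) (mx : idealr R) (k : nat) (M : lmodType R)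
    (A : submod M) : submod M :=
  @mulm R M (submod_pred (ideal_pow mx k)) A.

Lemma mulm_ideal_pow (R : comNzRingType) (mx : idealr R) (M : lmodType R) k
    (A : submod M) : mulm (ideal_pow mx k) A = powm mx k A :> submod M.
Proof. by apply: submod_eq. Qed.

Section Mulm.
Variable R : comNzRingType.
Implicit Types (M N : lmodType R) (I J : {pred R}).

Lemma mulm_mem M I (A : submod M) a x : a \in I -> x \in A ->
  a *: x \in mulm I A.
Proof.
move=> aI xA; apply/asboolP; exists 1%N, (fun=> a), (fun=> x).
by split=> //; rewrite big_ord1.
Qed.

Lemma mulm_min M I (A B : submod M) :
  (forall a x, a \in I -> x \in A -> a *: x \in B) -> {subset mulm I A <= B}.
Proof.
move=> AB y /asboolP[k [a [x [axP ->]]]]; apply: rpred_sum => i _.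
by have [aI xA] := axP i; exact: AB.
Qed.

Lemma mulm_mono M I J (A B : submod M) : {subset I <= J} -> {subset A <= B} ->
  {subset mulm I A <= mulm J B}.
Proof. by move=> IJ AB; apply: mulm_min => a x /IJ aJ /AB; exact: mulm_mem. Qed.

Lemma mulm_sub M I (A : submod M) : {subset mulm I A <= A}.
Proof. by apply: mulm_min => a x _ xA; rewrite rpredZ. Qed.

Lemma mapm_mulm M N (f : {linear M -> N}) I (A : submod M) :
  mapm f (mulm I A) = mulm I (mapm f A).
Proof.
apply: submod_anti.
  move=> y /mapmP[x xIA ->].
  have : {subset mulm I A <= comapm f (mulm I (mapm f A))}.
    by apply: mulm_min => a z aI zA; rewrite comapmE linearZ /= mulm_mem ?mem_mapm.
  by move=> /(_ _ xIA); rewrite comapmE.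
apply: mulm_min => a _ aI /mapmP[x xA ->]; rewrite -linearZ.
exact/mem_mapm/mulm_mem.
Qed.

Variable mx : idealr R.

Lemma mapm_powm M N (f : {linear M -> N}) k (A : submod M) :
  mapm f (powm mx k A) = powm mx k (mapm f A).
Proof. exact: mapm_mulm. Qed.

Lemma ideal_powS k : ideal_pow mx k.+1 = mulm mx (ideal_pow mx k).
Proof. by []. Qed.

Lemma powmS M k (A : submod M) :
  powm mx k.+1 A = mulm mx (powm mx k A).
Proof.
apply: submod_anti.
  apply: mulm_min => r x rk xA.
  have g : linear (fun r : R^o => r *: x).
    by move=> c u v; rewrite scalerDl scalerA.
  pose B := comapm (mklin g) (mulm mx (powm mx k A)).
  suff : {subset ideal_pow mx k.+1 <= B} by move=> /(_ _ rk); rewrite comapmE.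
  apply: mulm_min => a s am sk; rewrite comapmE mklinE -[a *: s]/(a * s) -scalerA.
  by apply: mulm_mem => //; exact: mulm_mem.
apply: mulm_min => a x am.
pose B := comapm (mklin (@scale_is_linear _ M a)) (powm mx k.+1 A).
suff : {subset powm mx k A <= B}.
  by move=> h /h; rewrite comapmE.
apply: mulm_min => r y rk yA; rewrite comapmE mklinE scalerA.
by apply: mulm_mem => //; exact: (mulm_mem (M := R^o)).
Qed.

Lemma powm0 M (A : submod M) : powm mx 0 A = A.
Proof.
apply: submod_anti; first exact: mulm_sub.
by move=> x xA; rewrite -[x]scale1r; exact: mulm_mem.
Qed.

Lemma ideal_powM j k a b : a \in ideal_pow mx j -> b \in ideal_pow mx k ->
  a * b \in ideal_pow mx (j + k).
Proof.
elim: j a => [|j IH] a; first by move=> _ bk; exact: submod_mull.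
rewrite addSn !ideal_powS => aj bk.
have sc : linear (fun r : R^o => r * b : R^o).
  by move=> c u v; rewrite mulrDl -!scalerAl.
suff : {subset mulm mx (ideal_pow mx j) <=
    comapm (mklin sc) (mulm mx (ideal_pow mx (j + k)))}.
  by move=> /(_ _ aj); rewrite comapmE.
apply: mulm_min => c x cm xj; rewrite comapmE mklinE -scalerAl.
by apply: mulm_mem => //; exact: IH.
Qed.

Lemma ideal_pow_mono j k : (j <= k)%N -> {subset ideal_pow mx k <= ideal_pow mx j}.
Proof.
move=> /subnKC <-; move: (k - j)%N => l; elim: j => [|j IH] //.
by rewrite addSn !ideal_powS; apply: mulm_mono.
Qed.

(** Brings annihilation by [ideal_pow mx h] down to products of [h] elements, the form that the
    pigeonhole needs. The induction replaces D by the elements that [a] multiplies into D. *)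
Lemma ideal_pow_ind h (D : submod R^o) :
  (forall s : seq R, size s = h -> {subset s <= mx} ->
     \prod_(a <- s) a \in D) -> {subset ideal_pow mx h <= D}.
Proof.
elim: h D => [|h IH] D hD.
  have := hD [::] erefl; rewrite big_nil => D1 x _.
  by rewrite -[x]mulr1; apply: (submod_mull (x : R)); exact: D1.
apply: mulm_min => a x am.
suff : {subset ideal_pow mx h <= comapm (mklin (@scale_is_linear _ R^o a)) D}.
  by move=> h' xh; have := h' x xh; rewrite (comapmE (mklin (@scale_is_linear _ R^o a))).
apply: IH => s sh sm; rewrite (comapmE (mklin (@scale_is_linear _ R^o a))) mklinE.
have := hD (a :: s); rewrite big_cons; apply; first by rewrite /= sh.
by move=> b; rewrite inE => /orP[/eqP->|/sm].
Qed.

Lemma pow_expr (a : R) k : a \in mx -> a ^+ k \in ideal_pow mx k.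
Proof.
move=> am; elim: k => // k IH; rewrite exprS ideal_powS.
exact: (mulm_mem (M := R^o)).
Qed.

End Mulm.

Section Local.
Variables (R : comNzRingType).
Hypothesis nR : noeth_mod R^o.

Lemma idealr_mull (J : idealr R) a b : b \in J -> a * b \in J.
Proof. exact: idealMr. Qed.

Lemma idealr_of_submod (I : submod R^o) : 1 \notin I ->
  exists J : idealr R, J =i I.
Proof.
move=> I1; have hI := submod_idealr_closed I1.
by exists (HB.pack_for (idealr R) (submod_pred I) (isIdealr.Build R (submod_pred I) hI)).
Qed.

Lemma submod_of_idealr (J : idealr R) : submod_closed (J : {pred R^o}).
Proof.
split=> [|c x y xJ yJ]; first exact: idealr0.
by rewrite rpredD // idealr_mull.
Qed.

(** An ideal maximal among those over I that miss S is prime: adjoining each of two outside elements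
    produces members of S, and if the product of the two elements were in the ideal, so would be the
    product of these members. *)
Lemma prime_avoiding (I : submod R^o) (S : R -> Prop) : S 1 ->
  (forall a b, S a -> S b -> S (a * b)) -> (forall a, a \in I -> ~ S a) ->
  exists p : prime_idealr R, {subset I <= p} /\ forall a, a \in p -> ~ S a.
Proof.
move=> S1 SM IS.
have [|q [[Iq qS] qmax]] := noeth_max (P := fun J : submod R^o =>
  {subset I <= J} /\ forall a, a \in J -> ~ S a) nR; first by exists I; split.
have q1 : 1 \notin q by apply/negP => /qS.
have hI := submod_idealr_closed q1.
have hit a : a \notin q -> exists s, S s /\ s \in adjoin (a : R^o) q.
  move=> aq; apply: contrapT => no.
  have e : adjoin (a : R^o) q = q.
    apply: qmax; last exact: adjoin_sub.
    by split=> [x /Iq xq|s sa Ss]; [exact: adjoin_sub|apply: no; exists s].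
  by case/negP: aq; rewrite -e; exact: adjoin_mem.
have hp : prime_idealr_closed (q : {pred R}).
  move=> u v uvq; apply/negPn/negP; rewrite negb_or => /andP[/hit[s [Ss]]].
  move=> /adjoinP[c sc] /hit[t [St /adjoinP[d td]]].
  apply: (qS (s * t)); last exact: SM.
  rewrite -(subrK (c * u) s) mulrDl rpredD //.
    by rewrite mulrC; exact: submod_mull.
  rewrite -(subrK (d * v) t) mulrDr rpredD //.
    by exact: submod_mull.
  by rewrite mulrACA; exact: submod_mull.
pose p : prime_idealr R := HB.pack_for (prime_idealr R) (submod_pred q)
  (isIdealr.Build R (submod_pred q) hI) (isPrimeIdealrClosed.Build R (submod_pred q) hp).
by exists p.
Qed.

Variable mx : idealr R.
Hypothesis lR : local_ring mx.

Lemma local_proper (I : submod R^o) : 1 \notin I -> {subset I <= mx}.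
Proof.
move=> I1; have [|q [[Iq q1] qmax]] := noeth_max (P := fun J : submod R^o =>
  {subset I <= J} /\ 1 \notin J) nR; first by exists I; split.
have [J Jq] := idealr_of_submod q1.
have Jmax : maximal_ideal J.
  move=> J' JJ' x xJ'.
  have e : Submod (submod_of_idealr J') = q.
    apply: qmax.
      split=> [y /Iq|]; first by rewrite -Jq; exact: JJ'.
      by apply/negP => h; have := idealr1 J'; rewrite [_ \in _]h.
    by move=> y; rewrite -Jq; exact: JJ'.
  by rewrite Jq -e.
by move=> x /Iq; rewrite -Jq (lR.2 _ Jmax).
Qed.

Lemma local_unit r : r \notin mx -> exists u, u * r = 1.
Proof.
move=> rm; have [|n1] := boolP ((1 : R^o) \in span [:: r : R^o]); last first.
  by case/negP: rm; apply: (local_proper n1); exact: adjoin_mem.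
by move=> /adjoinP[c /zeromP/eqP]; rewrite subr_eq0 => /eqP->; exists c.
Qed.

Lemma local_unit1B a : a \in mx -> exists u, u * (1 - a) = 1.
Proof.
move=> am; apply: local_unit; apply/negP => h.
have : 1 \in mx by rewrite -(subrK a 1) rpredD.
by rewrite idealr1.
Qed.

Lemma mulm_adjoin (M : lmodType R) (B : submod M) x z :
  z \in mulm mx (adjoin x B) -> exists2 a, a \in mx & z - a *: x \in mulm mx B.
Proof.
have P0 : exists2 a, a \in mx & 0 - a *: x \in mulm mx B.
  by exists 0; rewrite ?idealr0 // scale0r subr0 rpred0.
have PZD (c : R) y w : (exists2 a, a \in mx & y - a *: x \in mulm mx B) ->
    (exists2 a, a \in mx & w - a *: x \in mulm mx B) ->
    exists2 a, a \in mx & c *: y + w - a *: x \in mulm mx B.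
  move=> [a am ha] [b bm hb]; exists (c * a + b); first by rewrite rpredD ?idealr_mull.
  by rewrite scalerDl opprD addrACA -scalerA -scalerBr rpredD ?rpredZ.
suff : {subset mulm mx (adjoin x B) <= mksub P0 PZD}.
  by move=> h /h/(mksubP P0 PZD).
apply: mulm_min => a y am /adjoinP[c yc]; apply/(mksubP P0 PZD).
exists (a * c); first by rewrite mulrC idealr_mull.
by rewrite -scalerA -scalerBr; exact: mulm_mem.
Qed.

(** Elimination of generators: modulo A, [x] is a multiple [a *: x] plus a combination of the others
    with coefficients in [mx]. Since 1 - a is a unit, [x] can be substituted out of the
    hypothesis. *)
Lemma nakayama (M : lmodType R) (s : seq M) (A : submod M) :
  (forall y, y \in span s -> exists2 z, z \in mulm mx (span s) & y - z \in A) ->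
  {subset span s <= A}.
Proof.
elim: s => [|x s IH] h; first by move=> y /zeromP->; rewrite rpred0.
have [z /mulm_adjoin[a am za] xz] := h x (adjoin_mem _ _).
have [u u1] := local_unit1B am.
have xE : x - u *: (z - a *: x) \in A.
  rewrite -[X in X - _]scale1r -u1 -scalerA -scalerBr rpredZ //.
  by rewrite scalerBl scale1r opprB addrA subrK.
have sA : {subset span s <= A}.
  apply: IH => y ys; have [w /mulm_adjoin[b bm wb] yw] := h y (adjoin_sub x ys).
  exists (w - b *: x + (b * u) *: (z - a *: x)).
    by rewrite rpredD ?rpredZ.
  have -> : y - (w - b *: x + (b * u) *: (z - a *: x))
      = (y - w) + b *: (x - u *: (z - a *: x)).
    by rewrite (scalerBr b x) scalerA !opprD opprK !addrA.
  by rewrite rpredD ?rpredZ.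
have xA : x \in A.
  rewrite -(subrK (u *: (z - a *: x)) x) rpredD // rpredZ //.
  exact/sA/(mulm_sub za).
by apply: span_sub => y; rewrite inE => /orP[/eqP->//|ys]; exact/sA/mem_span.
Qed.

Lemma finite_length_killed1 (E : lmodType R) : fg (fullm E) ->
  (forall a (e : E), a \in mx -> a *: e = 0) -> finite_length E.
Proof.
move=> [s sE]; move: {-1}(size s) (erefl (size s)) => n.
elim: n E s sE => [|n IH] E [|x s] sE // => [_|[sn]] kE.
  apply: (@finite_length_inj _ _ ('I_0 -> E) (\0 : {linear E -> ('I_0 -> E)})).
    move=> y z _; have yf : y \in fullm E by [].
    have zf : z \in fullm E by [].
    by move: yf zf; rewrite sE => /zeromP-> /zeromP->.
  exists 0%N; apply/has_length_rlen; split; first exact: rchain0.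
  move=> [|k] // [X [C [_ _ /(_ 0%N isT)[_ []]]]] y _.
  suff -> : y = 0 by rewrite rpred0.
  by apply: funext => -[].
apply: (finite_length_exact (short_exact_sub (span [:: x]))).
  have [l hl] : exists l, rlen (zerom (subm_type (span [:: x]))) l; last first.
    by exists l; apply/has_length_rlen.
  (* A cyclic module killed by [mx] has length at most 1: an element outside [C 0] has a unit
     coefficient and so generates everything. *)
  apply: (@rlen_bounded _ _ _ 1) => -[|[|l]] // [X [C [C0 _ Cp]]].
  have [C01 /existsNP[y /not_implyP[yC1 yC0]]] := Cp 0%N isT.
  have [_ []] := Cp 1%N isT.
  have [c ycx] : exists c, submv _ y = c *: x.
    have /adjoinP[c /zeromP/eqP] := submvP y.
    by rewrite subr_eq0 => /eqP; exists c.
  have cm : c \notin mx.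
    apply/negP => cm; apply: yC0; suff -> : y = 0 by rewrite rpred0.
    by apply: submv_inj; rewrite ycx kE // linear0.
  move=> z _; have [d zdx] : exists c, submv _ z = c *: x.
    have /adjoinP[d /zeromP/eqP] := submvP z.
    by rewrite subr_eq0 => /eqP; exists d.
  have [u uc] := local_unit cm.
  suff -> : z = (d * u) *: y by rewrite rpredZ.
  by apply: submv_inj; rewrite zdx linearZZ ycx scalerA -mulrA uc mulr1.
have := IH (quotm (span [:: x])) (map (quotm_pi _) s); apply; last first.
- move=> a e am; by have [y <-] := quotm_surj e; rewrite -linearZ /= kE // linear0.
- by rewrite size_map.
have fE : fullm (quotm (span [:: x])) = mapm (quotm_pi _) (fullm E).
  apply: submod_anti => // y _; have [z <-] := quotm_surj y; exact: mem_mapm.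
rewrite fE sE mapm_span /=.
apply: submod_anti; last exact: adjoin_sub.
apply: (span_sub (s := quotm_pi _ x :: _)) => y; rewrite inE => /orP[/eqP->|ys];
  last exact: mem_span.
suff -> : quotm_pi (span [:: x]) x = 0 by rewrite rpred0.
by apply/quotm_pi_eq0; exact: adjoin_mem.
Qed.

Lemma fg_quotm (E : lmodType R) (A : submod E) : fg (fullm E) ->
  fg (fullm (quotm A)).
Proof. by apply: fg_full_surj (quotm_pi A) _; exact: quotm_surj. Qed.

Lemma fg_subm (E : lmodType R) (A : submod E) : fg (fullm E) ->
  fg (fullm (subm_type A)).
Proof.
move=> fE; have [s sE] := noeth_fg_mod nR fE A.
have [t tE] : exists t : seq (subm_type A), map (submv A) t = s.
  have : {subset s <= A} by rewrite sE; exact: mem_span.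
  elim: s {sE} => [|x s IH] sA; first by exists [::].
  have [|t tE] := IH; first by move=> y ys; apply: sA; rewrite inE ys orbT.
  by exists (Sub x (sA x (mem_head _ _)) :: t); rewrite /= tE.
exists t; apply: submod_anti => // y _.
have : submv A y \in mapm (submv A) (span t) by rewrite mapm_span tE -sE submvP.
by move=> /mapmP[z zt /submv_inj->].
Qed.

(** Induction through mE, which is killed by one power less, and E / mE, which is killed by [mx]. *)
Lemma finite_length_killed (E : lmodType R) h : fg (fullm E) ->
  (forall r, r \in ideal_pow mx h -> forall e : E, r *: e = 0) ->
  finite_length E.
Proof.
elim: h E => [|h IH] E fE kE.
  apply: finite_length_killed1 => // a e am.
  by rewrite -[e]scale1r kE ?scaler0.
apply: (finite_length_exact (short_exact_sub (mulm mx (fullm E)))).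
  apply: IH; first exact: fg_subm.
  move=> r rh e; apply: submv_inj; rewrite linear0 linearZ /=.
  have : {subset mulm mx (fullm E) <= comapm (mklin (@scale_is_linear _ E r)) (zerom E)}.
    apply: mulm_min => a x am _; rewrite comapmE mklinE scalerA mulrC kE ?rpred0 //.
    exact: (mulm_mem (M := R^o)).
  by move=> /(_ _ (submvP e)); rewrite comapmE mklinE => /zeromP.
apply: finite_length_killed1; first exact: fg_quotm.
move=> a e am; have [y <-] := quotm_surj e; rewrite -linearZ.
by apply/quotm_pi_eq0; exact: mulm_mem.
Qed.

End Local.

(** * The theorems of Artin-Rees and Krull *)

Lemma hilbert_basis (A : comNzRingType) :
  noeth_mod A^o -> noeth_mod ({poly A}^o).
Proof.
move=> nA J.
have L0 n : exists p : {poly A}, [/\ p \in J, (size p <= n.+1)%N & p`_n = 0].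
  by exists 0; rewrite size_poly0 coef0; split=> //; exact: (rpred0 J).
have LZD n (c : A) (a b : A^o) :
    (exists p : {poly A}, [/\ p \in J, (size p <= n.+1)%N & p`_n = a]) ->
    (exists p : {poly A}, [/\ p \in J, (size p <= n.+1)%N & p`_n = b]) ->
    exists p : {poly A}, [/\ p \in J, (size p <= n.+1)%N & p`_n = c *: a + b].
  move=> [p [pJ sp <-]] [q [qJ sq <-]]; exists (c *: p + q).
  split; last by rewrite coefD coefZ.
    rewrite -mul_polyC.
    exact: (@rpredD _ J (c%:P * p : {poly A}^o) q (submod_mull _ pJ) qJ).
  rewrite (leq_trans (size_polyD _ _)) // geq_max sq andbT.
  exact: leq_trans (size_scale_leq _ _) sp.
(* The coefficients in degree [n] of members of J of degree at most [n]. These ideals increase with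
   [n], and one of them, [L n0], is maximal. *)
pose L n := mksub (L0 n) (LZD n).
have LP n a : a \in L n <-> exists p : {poly A}, [/\ p \in J, (size p <= n.+1)%N & p`_n = a].
  by split=> [/(mksubP (L0 n) (LZD n))|h]; last exact/(mksubP (L0 n) (LZD n)).
have Lmono n k : {subset L n <= L (n + k)%N}.
  move=> a /LP[p [pJ sp pa]]; apply/LP; exists ('X^k * p); split.
  - exact: submod_mull.
  - rewrite (leq_trans (size_polyMleq _ _)) // size_polyXn /=.
    by rewrite addnC -addSn leq_add2r.
  - by rewrite coefXnM ltnNge leq_addl /= addnK.
have [|_ [[n0 ->] Lmax]] := noeth_max (P := fun B => exists n, B = L n) nA.
  by exists (L 0%N), 0%N.
have J0 : (0 : {poly A}) \in J /\ (size (0%R : {poly A}) <= n0.+1)%N.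
  by rewrite size_poly0; split=> //; exact: (rpred0 J).
have JZD (c : A) (p q : {poly A}) : p \in J /\ (size p <= n0.+1)%N ->
    q \in J /\ (size q <= n0.+1)%N ->
    c *: p + q \in J /\ (size (c *: p + q)%R <= n0.+1)%N.
  move=> [pJ sp] [qJ sq]; split.
    rewrite -mul_polyC.
    exact: (@rpredD _ J (c%:P * p : {poly A}^o) q (submod_mull _ pJ) qJ).
  rewrite (leq_trans (size_polyD _ _)) // geq_max sq andbT.
  exact: leq_trans (size_scale_leq _ _) sp.
(* The members of J of degree at most [n0] form a finitely generated A-module. Its generators
   suffice for J, because a higher leading term is cancelled by a power of X times such a member. *)
pose J' := mksub J0 JZD.
have [s sE] : fg J'.
  apply: (fg_sub_span (s := [seq 'X^i | i <- iota 0 n0.+1])) => // p.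
  move=> /(mksubP J0 JZD)[_ sp]; rewrite -(coefK p) poly_def.
  apply: rpred_sum => i _; apply: rpredZ; apply: mem_span; apply: map_f.
  by rewrite mem_iota /= add0n (leq_trans (ltn_ord i)).
have spanP (p : {poly A}) : p \in span s -> (p : {poly A}^o) \in span (s : seq {poly A}^o).
  elim: (s) p => [|q t IH] p; first by move=> /zeromP->; exact: (rpred0 (zerom _)).
  move=> /adjoinP[c /IH h]; apply/adjoinP; exists c%:P.
  by rewrite -[c%:P *: _]/(c%:P * q) mul_polyC.
exists s; apply: submod_anti; last first.
  apply: span_sub => p ps; have : p \in J' by rewrite sE; exact: mem_span.
  by move=> /(mksubP J0 JZD)[].
move=> p; have [n] := ubnP (size p); elim: n p => // n IH p.
rewrite ltnS => spn pJ.
have [sp|sp] := leqP (size p) n0.+1.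
  by apply: spanP; rewrite -sE; apply/(mksubP J0 JZD).
case: n IH spn => [|n] IH spn; first by move: sp; rewrite ltnNge (leq_trans spn).
have [k pk] : exists k, size p = (n0 + k).+2.
  by exists (size p - n0.+2)%N; rewrite -!addSn subnKC.
have : p`_(n0 + k).+1 \in L (n0 + k).+1 by apply/LP; exists p; rewrite pk.
have -> : L (n0 + k).+1 = L n0.
  by apply: Lmax; [exists (n0 + k).+1|rewrite -addnS; exact: Lmono].
move=> /LP[q [qJ sq pq]].
have qs : q \in span (s : seq {poly A}^o).
  by apply: spanP; rewrite -sE; apply/(mksubP J0 JZD).
rewrite -(subrK ('X^(k.+1) * q) p).
apply: (@rpredD _ (span (s : seq {poly A}^o)) (p - 'X^(k.+1) * q) ('X^(k.+1) * q : {poly A}^o));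
  last exact: submod_mull.
apply: IH; last first.
  exact: (@rpredB _ J (p : {poly A}^o) ('X^(k.+1) * q : {poly A}^o) pJ (submod_mull _ qJ)).
rewrite (leq_trans _ spn) // pk ltnS; apply/leq_sizeP => j.
rewrite leq_eqVlt => /orP[/eqP<-|kj].
  rewrite coefB coefXnM ltnNge -addnS leq_addl /= addnK pq addnS subrr //.
rewrite coefB coefXnM nth_default ?pk //.
case: ifP => kj'; rewrite ?subr0 // nth_default ?subr0 //.
rewrite (leq_trans sq) // leq_subRL; last by rewrite leqNgt kj'.
by rewrite addnC addSn addnS.
Qed.

Section Rees.
Variables (R : comNzRingType) (mx : idealr R).
Hypothesis nR : noeth_mod R^o.

Definition graded (p : {poly R}) := forall k, p`_k \in ideal_pow mx k.

Lemma gradedD p q : graded p -> graded q -> graded (p + q).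
Proof.
move=> hp hq k; rewrite coefD.
exact: (@rpredD _ (ideal_pow mx k) (p`_k : R^o) q`_k (hp k) (hq k)).
Qed.

Lemma gradedM p q : graded p -> graded q -> graded (p * q).
Proof.
move=> hp hq k; rewrite coefM; apply: (@rpred_sum R^o (ideal_pow mx k)) => i _.
rewrite -[X in ideal_pow mx X](subnKC (leq_ord i)).
exact: ideal_powM (hp _) (hq _).
Qed.

Lemma gradedC c : graded c%:P.
Proof. by move=> [|k]; rewrite coefC //=; exact: (rpred0 (ideal_pow mx k.+1)). Qed.

Lemma gradedX a : a \in mx -> graded (a *: 'X).
Proof.
move=> am k; rewrite coefZ coefX; case: k => [|[|k]] //=.
- rewrite mulr1 -[a]mulr1; exact: (@mulm_mem R R^o mx (fullm _) a 1).
- by rewrite mulr0; exact: (rpred0 (ideal_pow mx k.+2)).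
Qed.

(* A is a polynomial ring over R whose image in R[X] is generated by the a *: 'X,
   hence equals the Rees ring when the list generates mx. *)
Lemma rees_seq (l : seq R) : {subset l <= mx} ->
  exists (A : comNzRingType) (f : {rmorphism A -> {poly R}}),
    [/\ noeth_mod A^o, forall s, graded (f s), forall c, exists s, f s = c%:P &
        forall a, a \in l -> exists s, f s = a *: 'X].
Proof.
elim: l => [|a l IH] lm.
  exists R, (polyC : {rmorphism R -> {poly R}}); split=> // [s|c].
    exact: gradedC.
  by exists c.
have [|A [f [nA fg fC fX]]] := IH; first by move=> b bl; rewrite lm // inE bl orbT.
have cfu : commr_rmorph f (a *: 'X) by move=> x; exact: mulrC.
exists {poly A}, (horner_morph cfu : {rmorphism {poly A} -> {poly R}}); split.
- exact: hilbert_basis.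
- elim/poly_ind => [|p c IHp]; first by rewrite rmorph0; exact: (gradedC 0).
  rewrite rmorphD rmorphM /= horner_morphX horner_morphC.
  apply: gradedD; last exact: fg.
  by apply: gradedM => //; apply/gradedX/lm/mem_head.
- by move=> c; have [s sE] := fC c; exists s%:P; rewrite /= horner_morphC.
- move=> b; rewrite inE => /orP[/eqP->|/fX[s sE]].
    by exists 'X; rewrite /= horner_morphX.
  by exists s%:P; rewrite /= horner_morphC.
Qed.

Lemma rees_ring : exists (A : comNzRingType) (f : {rmorphism A -> {poly R}}),
  [/\ noeth_mod A^o, forall s, graded (f s) &
      forall k r, r \in ideal_pow mx k -> exists s, f s = r *: 'X^k].
Proof.
have [l lE] := nR (Submod (submod_of_idealr mx)).
have lm : {subset l <= mx}.
  move=> x xl; have : (x : R^o) \in span (l : seq R^o) by exact: mem_span.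
  by rewrite -lE.
have [A [f [nA fgraded fC fX]]] := rees_seq lm.
exists A, f; split=> //.
have D0 k : exists s, f s = (0 : R) *: 'X^k by exists 0; rewrite rmorph0 scale0r.
have DZD k (c : R) (a b : R^o) : (exists s, f s = a *: 'X^k) ->
    (exists s, f s = b *: 'X^k) -> exists s, f s = (c *: a + b) *: 'X^k.
  move=> [s sE] [t tE]; have [u uE] := fC c; exists (u * s + t).
  by rewrite rmorphD rmorphM sE tE uE mul_polyC scalerA scalerDl.
have DP k (a : R^o) : a \in mksub (D0 k) (DZD k) <-> exists s, f s = a *: 'X^k.
  by split=> [/(mksubP (D0 k) (DZD k))|h]; last exact/(mksubP (D0 k) (DZD k)).
elim=> [|k IH] r.
  by move=> _; have [s sE] := fC r; exists s; rewrite sE expr0 alg_polyC.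
rewrite ideal_powS => rk; apply/DP; apply: mulm_min r rk => a x am xk; apply/DP.
have [s sE] := IH _ xk.
have [t tE] : exists s, f s = a *: 'X^1.
  apply/DP; have : (a : R^o) \in span (l : seq R^o) by rewrite -lE.
  by apply: span_sub => b /fX[t tE]; apply/DP; exists t.
by exists (t * s); rewrite rmorphM sE tE -scalerAl -scalerAr scalerA -exprD.
Qed.

End Rees.

Definition restr_type (A B : comNzRingType) (f : {rmorphism A -> B})
  (V : lmodType B) : Type := V.

Section Restriction.
Variables (A B : comNzRingType) (f : {rmorphism A -> B}) (V : lmodType B).

Local Notation VA := (restr_type f V).
HB.instance Definition _ := GRing.Zmodule.on VA.

Definition restr_scale (a : A) (v : VA) : VA := f a *: (v : V).

Lemma restr_scalerA a b v : restr_scale a (restr_scale b v) = restr_scale (a * b) v.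
Proof. by rewrite /restr_scale scalerA rmorphM. Qed.
Lemma restr_scale1r : left_id 1 restr_scale.
Proof. by move=> v; rewrite /restr_scale rmorph1 scale1r. Qed.
Lemma restr_scalerDr : right_distributive restr_scale +%R.
Proof. by move=> a u v; rewrite /restr_scale scalerDr. Qed.
Lemma restr_scalerDl v : {morph restr_scale^~ v : a b / a + b}.
Proof. by move=> a b; rewrite /restr_scale rmorphD scalerDl. Qed.

HB.instance Definition _ := GRing.Zmodule_isLmodule.Build A VA
  restr_scalerA restr_scale1r restr_scalerDr restr_scalerDl.

Lemma restr_scaleE a (v : VA) : a *: v = f a *: (v : V) :> V.
Proof. by []. Qed.

End Restriction.

Lemma mulm_span (R : comNzRingType) (M : lmodType R) (I : submod R^o)
    (s : seq M) x : x \in @mulm R M (submod_pred I) (span s) ->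
  exists y : 'I_(size s) -> R, (forall j, y j \in I) /\
    x = \sum_(j < size s) y j *: s`_j.
Proof.
pose P (z : M) := exists y : 'I_(size s) -> R, (forall j, y j \in I) /\
  z = \sum_(j < size s) y j *: s`_j.
have P0 : P 0.
  exists (fun=> 0); split=> [j|]; first exact: (rpred0 I).
  by rewrite big1 // => j _; rewrite scale0r.
have PZD (c : R) u v : P u -> P v -> P (c *: u + v).
  move=> [y [yI ->]] [z [zI ->]]; exists (fun j => c * y j + z j); split=> [j|].
    exact: (@rpredD _ I (c * y j : R^o) _ (submod_mull _ (yI j)) (zI j)).
  rewrite scaler_sumr -big_split /=; apply: eq_bigr => j _.
  by rewrite scalerDl scalerA.
move=> xI; apply/(mksubP P0 PZD); apply: mulm_min x xI => a x aI.
move=> xs; have [c ->] := span_sum xs; apply/(mksubP P0 PZD).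
exists (fun j => a * c j); split=> [j|]; first by rewrite mulrC submod_mull.
by rewrite scaler_sumr; apply: eq_bigr => j _; rewrite scalerA.
Qed.

Section ArtinRees.
Variables (R : comNzRingType) (mx : idealr R).
Hypothesis nR : noeth_mod R^o.

Theorem artin_rees (K : lmodType R) (B : submod K) : fg (fullm K) ->
  exists c, forall k x, x \in powm mx (k + c) (fullm K) ->
    x \in B -> x \in powm mx k B.
Proof.
move=> [s sE]; have [A [f [nA fgraded fim]]] := rees_ring mx nR.
pose q := size s.
pose V := restr_type f 'rV[{poly R}]_q.
(* The element of K that the degree [k] part of a tuple represents through the generators [s]. *)
pose co (w : 'rV[{poly R}]_q) k := \sum_j (w 0 j)`_k *: s`_j.
have coD u v k : co (u + v) k = co u k + co v k.
  by rewrite /co -big_split; apply: eq_bigr => j _; rewrite mxE coefD scalerDl.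
have coM (p : {poly R}) v k : co (p *: v) k = \sum_(i < k.+1) p`_i *: co v (k - i)%N.
  rewrite /co; under [RHS]eq_bigr do rewrite scaler_sumr.
  rewrite exchange_big; apply: eq_bigr => j _.
  by rewrite mxE coefM scaler_suml; apply: eq_bigr => i _; rewrite scalerA.
(* The tuples over the Rees ring all of whose graded pieces land in B form a
   finitely generated module over it; c bounds the degrees of its generators. *)
pose P (w : V) := (forall j, exists t, f t = (w : 'rV[{poly R}]_q) 0 j) /\
  forall k, co w k \in B.
have P0 : P 0.
  split=> [j|k]; first by exists 0; rewrite rmorph0 mxE.
  by rewrite /co big1 ?rpred0 // => j _; rewrite mxE coef0 scale0r.
have PZD (a : A) (u v : V) : P u -> P v -> P (a *: u + v).
  move=> [ui uB] [vi vB]; split=> [j|k].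
    have [[t tE] [t' tE']] := (ui j, vi j); exists (a * t + t').
    by rewrite rmorphD rmorphM tE tE' /= restr_scaleE [RHS]mxE [X in _ = X + _]mxE.
  rewrite coD rpredD // coM rpred_sum // => i _; exact: rpredZ.
have [ws wsE] : fg (mksub P0 PZD).
  apply: (fg_sub_span (s := [seq (delta_mx 0 j : V) | j <- enum 'I_q])) => // w.
  move=> /(mksubP P0 PZD)[wi _].
  rewrite -[w]/((w : 'rV[{poly R}]_q) : V) [X in X \in _](row_sum_delta (w : 'rV[{poly R}]_q)).
  apply: rpred_sum => j _; have [t tE] := wi j.
  rewrite -tE -[X in X \in _]/(t *: (delta_mx 0 j : V)) rpredZ //.
  by apply: mem_span; rewrite map_f // mem_enum.
have [c hc] : exists c, forall w, w \in ws -> forall k, (c <= k)%N -> co w k = 0.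
  elim: (ws) => [|w l [c hc]]; first by exists 0%N.
  pose d := \max_(j < q) size ((w : 'rV[{poly R}]_q) 0%R j).
  exists (c + d)%N => w'; rewrite inE => /orP[/eqP->|/hc h] k ck.
    rewrite /co big1 // => j _; rewrite nth_default ?scale0r //.
    rewrite (leq_trans _ ck) // (leq_trans _ (leq_addl _ _)) //.
    exact: (leq_bigmax_cond (F := fun j => size ((w : 'rV[{poly R}]_q) 0%R j))).
  exact/h/(leq_trans (leq_addr _ _) ck).
have wsB w : w \in ws -> forall k, co w k \in B.
  move=> wws; have : w \in mksub P0 PZD by rewrite wsE; exact: mem_span.
  by move=> /(mksubP P0 PZD)[].
exists c => k x xk xB.
(* In degree k + c of a multiple of [w0], a coefficient of degree i meets the part of [w0] in degree
   k + c - i. For i <= k that part vanishes by the choice of [c]; for i > k the coefficient lies in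
   m^i, inside m^k. *)
have key w : w \in span ws -> co w (k + c)%N \in powm mx k B.
  elim: (ws) hc wsB w => [|w0 l IH] hc wsB w.
    move=> /zeromP->; rewrite /co big1 ?rpred0 // => j _.
    by rewrite mxE coef0 scale0r.
  move=> /adjoinP[a wl].
  have -> : w = ((w - a *: w0 : V) : 'rV[{poly R}]_q) + f a *: (w0 : 'rV[{poly R}]_q).
    by rewrite [RHS]subrK.
  rewrite coD rpredD //.
    by apply: IH wl => [u ul|u ul]; [apply: hc|apply: wsB]; rewrite inE ul orbT.
  rewrite coM rpred_sum // => i _.
  have [ik|ki] := leqP i k.
    by rewrite hc ?mem_head ?scaler0 ?rpred0 // leq_subRL ?leq_ord // leq_add2r.
  apply: mulm_mem; last by apply: wsB; exact: mem_head.
  exact: ideal_pow_mono (ltnW ki) _ (fgraded _ _).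
move: xk; rewrite sE => /mulm_span[y [yI xE]].
(* A tuple that represents [x], concentrated in the single degree k + c. *)
pose w : 'rV[{poly R}]_q := \row_j (y j *: 'X^(k + c)).
have cow i : co w i = if i == (k + c)%N then x else 0.
  rewrite /co; case: eqP => [->|/eqP ine].
    rewrite xE; apply: eq_bigr => j _.
    by rewrite mxE coefZ coefXn eqxx mulr1.
  by rewrite big1 // => j _; rewrite mxE coefZ coefXn (negPf ine) mulr0 scale0r.
have wW : (w : V) \in span ws.
  rewrite -wsE; apply/(mksubP P0 PZD); split=> [j|i].
    by rewrite mxE; exact: fim.
  by rewrite cow; case: eqP => // _; rewrite rpred0.
by have := key _ wW; rewrite cow eqxx.
Qed.

(** The class y of x lies in every m^k (K / B). Artin-Rees for the submodule Ry at exponent 1 puts y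
    in m y, and Nakayama concludes. *)
Theorem krull_intersection (K : lmodType R) (B : submod K) x :
  local_ring mx -> fg (fullm K) ->
  (forall k, x \in addm B (powm mx k (fullm K))) -> x \in B.
Proof.
move=> lR fK xB; apply/quotm_pi_eq0.
have fQ : fg (fullm (quotm B)) by exact: fg_quotm.
set y := quotm_pi B x.
have [c hc] := artin_rees (span [:: y]) fQ.
have yk k : y \in powm mx k (fullm (quotm B)).
  have /addmP[b bB xb] := xB k.
  have -> : y = quotm_pi B (x - b).
    by apply/quotm_piP; rewrite opprB addrCA subrr addr0.
  have -> : fullm (quotm B) = mapm (quotm_pi B) (fullm K).
    apply: submod_anti => // z _; have [u <-] := quotm_surj z; exact: mem_mapm.
  by rewrite -mapm_powm; exact: mem_mapm.
have y1 : y \in mulm mx (span [:: y]).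
  have := hc 1%N y (yk _) (adjoin_mem _ _).
  by rewrite powmS powm0.
apply/zeromP; apply: (nakayama nR lR (s := [:: y])); last exact: adjoin_mem.
move=> z zy; exists z; last by rewrite subrr rpred0.
by apply: span_sub z zy => z; rewrite inE => /eqP->.
Qed.

End ArtinRees.

(** * Depth *)

Section FgExact.
Variables (R : comNzRingType) (N K M : lmodType R).
Variables (i : {linear N -> K}) (p : {linear K -> M}).

Lemma fg_exact : (forall y, exists x, p x = y) ->
  (forall x, p x = 0 -> exists n, x = i n) ->
  fg (fullm N) -> fg (fullm M) -> fg (fullm K).
Proof.
move=> ps ip [s sE] [t tE]; have [g gP] := choice ps.
exists (map i s ++ map g t); apply: submod_anti => // x _.
have tM : map p (map g t) = t by rewrite -map_comp map_id_in // => y _ /=; exact: gP.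
have : p x \in mapm p (span (map g t)) by rewrite mapm_span tM -tE.
move=> /mapmP[y yt pxy]; rewrite -(subrK y x) rpredD //; last first.
  by apply: span_mono yt => z zt; rewrite mem_cat zt orbT.
have [|n ->] := ip (x - y); first by rewrite linearB pxy subrr.
have : i n \in mapm i (span s) by rewrite -sE; exact: mem_mapm.
by rewrite mapm_span; apply: span_mono => z zs; rewrite mem_cat zs.
Qed.

End FgExact.

Section Product.
Variables (R : comNzRingType) (M N : lmodType R).

Lemma inl_linear : linear (fun x : M => (x, 0) : M * N).
Proof. by move=> c x y; congr (_, _); rewrite /= scaler0 addr0. Qed.
Lemma inr_linear : linear (fun x : N => (0, x) : M * N).
Proof. by move=> c x y; congr (_, _); rewrite /= scaler0 addr0. Qed.
Lemma fst_linear : linear (fst : M * N -> M). Proof. by []. Qed.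
Lemma snd_linear : linear (snd : M * N -> N). Proof. by []. Qed.

Lemma fg_prod : fg (fullm M) -> fg (fullm N) -> fg (fullm (M * N)%type).
Proof.
apply: (fg_exact (i := mklin inl_linear) (p := mklin snd_linear)) => [y|x].
  by exists (0, y).
by case: x => [x y] /= ->; exists x.
Qed.

Lemma prodm0 (A : submod M) (B : submod N) : (0 : M * N).1 \in A /\ (0 : M * N).2 \in B.
Proof. by rewrite !rpred0. Qed.
Lemma prodmZD (A : submod M) (B : submod N) (c : R) (x y : M * N) :
  x.1 \in A /\ x.2 \in B -> y.1 \in A /\ y.2 \in B ->
  (c *: x + y).1 \in A /\ (c *: x + y).2 \in B.
Proof. by move=> [x1 x2] [y1 y2]; rewrite !rpredD ?rpredZ. Qed.
Definition prodm A B : submod (M * N)%type :=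
  mksub (@prodm0 A B) (@prodmZD A B).
Lemma prodmP (A : submod M) (B : submod N) (x : M * N) :
  reflect (x.1 \in A /\ x.2 \in B) (x \in prodm A B).
Proof. exact: mksubP. Qed.

End Product.

Section Depth.
Variables (R : comNzRingType) (mx : idealr R).
Implicit Types M N K : lmodType R.

Definition nzd M (a : R) (A : submod M) := forall y, a *: y \in A -> y \in A.

(* M / A has a regular sequence of length d in mx; working with submodules of a
   fixed M avoids iterated quotients. *)
Fixpoint depth_ge M d (A : submod M) : Prop :=
  if d is e.+1 then exists2 a, a \in mx & nzd a A /\ depth_ge e (consm a A)
  else exists y, y \notin A.

Lemma consmC M a b (A : submod M) : consm a (consm b A) = consm b (consm a A).
Proof.
suff h a' b' : {subset consm a' (consm b' A) <= consm b' (consm a' A)}.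
  by apply: submod_anti; exact: h.
move=> x /consmP[y /consmP[z xyz]]; apply/consmP; exists z; apply/consmP; exists y.
by rewrite addrAC.
Qed.

Fixpoint regular_mod M (A : submod M) (xs : seq R) : Prop :=
  if xs is x :: ys then nzd x A /\ regular_mod (consm x A) ys
  else exists y, y \notin A.

Lemma addm_min M (A B C : submod M) : {subset A <= C} -> {subset B <= C} ->
  {subset addm A B <= C}.
Proof.
by move=> AC BC x /addmP[a /AC aC /BC bC]; rewrite -(subrK a x) rpredD.
Qed.

Lemma addm_mulm_cons M (A : submod M) x s :
  addm A (mulm [in x :: s] (fullm M)) = addm (consm x A) (mulm [in s] (fullm M)).
Proof.
apply: submod_anti; apply: addm_min.
- by move=> y yA; apply/addml/consm_sub.
- apply: mulm_min => a y; rewrite inE => /orP[/eqP-> _|sa _].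
    exact/addml/consm_scale.
  exact/addmr/mulm_mem.
- move=> y /consmP[z yz]; apply/addmP; exists (y - x *: z) => //.
  by rewrite opprB addrC subrK mulm_mem // inE eqxx.
- move=> y /(mulm_mono (J := [in x :: s]) (B := fullm M)) h; apply/addmr/h => //.
  by move=> z zs; rewrite inE (zs : z \in s) orbT.
Qed.

Lemma regular_modP M (A : submod M) xs : regular_mod A xs <->
  (forall i, (i < size xs)%N ->
     nzd xs`_i (addm A (mulm [in take i xs] (fullm M)))) /\
  exists y, y \notin addm A (mulm [in xs] (fullm M)).
Proof.
have nil B : addm B (mulm [in [::]] (fullm M)) = B.
  apply: submod_anti; last exact: addml.
  by apply: addm_min => //; apply: mulm_min => a x; rewrite inE.
elim: xs A => [|x s IH] A.
  split=> [[y yA]|[_ [y yA]]]; last by exists y; rewrite nil in yA.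
  by split=> //; exists y; rewrite nil.
rewrite addm_mulm_cons; split=> [[xA /IH[h1 h2]]|[h1 h2]].
  split=> // -[_|i]; first by rewrite nil.
  by rewrite -[take _ _]/(x :: take i s) ltnS addm_mulm_cons; exact: h1.
split; first by have := h1 0%N isT; rewrite nil.
apply/IH; split=> // i hi.
by have := h1 i.+1 hi; rewrite -[take _ _]/(x :: take i s) addm_mulm_cons.
Qed.

Lemma regular_seqP M xs : regular_seq M xs <-> regular_mod (zerom M) xs.
Proof.
have z0 (B : submod M) : addm (zerom M) B = B.
  apply: submod_anti; last exact: addmr.
  by apply: addm_min => // x /zeromP->; rewrite rpred0.
rewrite regular_modP z0; split=> -[h1 [y hy]]; split.
- move=> i hi z; rewrite z0 => hz; apply/quotm_pi_eq0; apply: (h1 i hi).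
  by rewrite -linearZ; apply/quotm_pi_eq0.
- have [z zy] := quotm_surj y; exists z; apply/negP => /quotm_pi_eq0 zm.
  by move: hy; rewrite -zy zm eqxx.
- move=> i hi q; have [z <-] := quotm_surj q; rewrite -linearZ => /quotm_pi_eq0 hz.
  by apply/quotm_pi_eq0; have := h1 i hi z; rewrite z0; apply.
- exists (quotm_pi _ y); apply/eqP => /quotm_pi_eq0 hy'.
  by move: hy; rewrite hy'.
Qed.

Lemma depth_geP M d : (exists xs : seq R,
    [/\ size xs = d, {subset xs <= mx} & regular_seq M xs]) <->
  depth_ge d (zerom M).
Proof.
suff h (A : submod M) : (exists xs : seq R,
    [/\ size xs = d, {subset xs <= mx} & regular_mod A xs]) <-> depth_ge d A.
  rewrite -h; split=> -[xs [h1 h2 h3]]; exists xs; split=> //; exact/regular_seqP.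
elim: d A => [|d IH] A /=.
  split=> [[xs [/size0nil-> _]]|h] //.
  by exists [::]; split.
split=> [[[|x xs] [] // [sz] sm [xA rA]]|[x xm [xA /IH[xs [sz sm rA]]]]].
  exists x; first exact/sm/mem_head.
  by split=> //; apply/IH; exists xs; split=> // y ys; apply: sm; rewrite inE ys orbT.
exists (x :: xs); split=> //=; first by rewrite sz.
by move=> y; rewrite inE => /orP[/eqP->|/sm].
Qed.

Hypotheses (nR : noeth_mod R^o) (lR : local_ring mx).

Lemma mul_lin_linear M (u : M) : linear (fun a : R^o => a *: u).
Proof. by move=> c a b; rewrite scalerDl scalerA. Qed.

Definition colon M (A : submod M) (u : M) : submod R^o :=
  comapm (mklin (mul_lin_linear u)) A.
Lemma colonE M (A : submod M) u (a : R) : (a \in colon A u) = (a *: u \in A).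
Proof. exact: comapmE. Qed.

(* Annihilators modulo A that are maximal are prime, and there are finitely many
   of them because M is Noetherian; they cover the zero divisors on M / A. *)
Definition maxann M (A : submod M) u := u \notin A /\
  forall v, v \notin A -> {subset colon A u <= colon A v} ->
  {subset colon A v <= colon A u}.

Section Avoidance.
Variables (M : lmodType R) (fM : fg (fullm M)) (A : submod M).

Lemma maxann_exists u : u \notin A ->
  exists2 v, maxann A v & {subset colon A u <= colon A v}.
Proof.
move=> uA; have [|_ [[v [vA -> uv]] vmax]] := noeth_max (P := fun J =>
  exists v, [/\ v \notin A, J = colon A v & {subset colon A u <= J}]) nR.
  by exists (colon A u), u; split.
exists v => //; split=> // w wA vw.
by rewrite (vmax (colon A w)) //; exists w; split=> // a /uv/vw.
Qed.

(** If b v is outside A, its annihilator modulo A contains that of v, hence equals it by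
    maximality. *)
Lemma maxann_prime v (a b : R) : maxann A v -> a * b \in colon A v ->
  a \in colon A v \/ b \in colon A v.
Proof.
move=> [vA vmax] abv; have [bv|bv] := boolP (b *: v \in A).
  by right; rewrite colonE.
left; apply: (vmax _ bv).
  by move=> c; rewrite !colonE scalerA mulrC -scalerA => cv; rewrite rpredZ.
by rewrite colonE scalerA -colonE.
Qed.

(** Since [colon A v] is prime, a factor taken from [colon A u] outside it can be cancelled, one [u]
    at a time. *)
Lemma maxann_inter_sub v (us : seq M) : maxann A v ->
  (forall a : R, (forall u, u \in us -> a \in colon A u) -> a \in colon A v) ->
  exists2 u, u \in us & {subset colon A u <= colon A v}.
Proof.
move=> mv; elim: us => [|u us IH] h.
  have := h 1; rewrite colonE scale1r => vA.
  by case: mv => /negP[]; apply: vA.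
have [uv|uv] := pselect {subset colon A u <= colon A v}.
  by exists u => //; exact: mem_head.
have [a au av] : exists2 a, a \in colon A u & a \notin colon A v.
  apply: contrapT => no; apply: uv => a au; apply/negPn/negP => av.
  by apply: no; exists a.
have [|w wus wv] := IH; last by exists w => //; rewrite inE wus orbT.
move=> b hb; have : a * b \in colon A v.
  apply: h => w; rewrite inE => /orP[/eqP->|/hb bw]; last exact: submod_mull.
  by rewrite mulrC submod_mull.
by move=> /(maxann_prime mv)[av'|//]; rewrite av' in av.
Qed.

(** The [us] have a maximal span among all such lists, so a further [v] lies in this span and its
    annihilator contains the intersection of theirs. *)
Lemma maxann_finite : exists us : seq M, (forall u, u \in us -> maxann A u) /\
  forall v, maxann A v -> exists2 u, u \in us & {subset colon A v <= colon A u}.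
Proof.
have nM := noeth_fg_mod nR fM.
have [|_ [[us [-> hus]] usmax]] := noeth_max (P := fun B : submod M =>
  exists us, B = span us /\ forall u, u \in us -> maxann A u) nM.
  by exists (zerom M), [::].
exists us; split=> // v mv.
have [|u uus uv] := @maxann_inter_sub v us mv.
  have vus : v \in span us.
    rewrite -(usmax (span (v :: us))); [exact: adjoin_mem| |exact: adjoin_sub].
    by exists (v :: us); split=> // u; rewrite inE => /orP[/eqP->|/hus].
  move=> a ha; rewrite colonE.
  have : {subset span us <= comapm (mklin (@scale_is_linear _ M a)) A}.
    apply: span_sub => u uus; rewrite comapmE mklinE -colonE; exact: ha.
  by move=> /(_ _ vus); rewrite comapmE.
exists u => //; exact: (hus u uus).2 mv.1 uv.
Qed.

(** Vanishing of Hom(R / m, M / A), the test for the existence of a nonzerodivisor in [mx]. *)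
Definition socle_free := forall u, (forall a, a \in mx -> a *: u \in A) -> u \in A.

Lemma exists_nzd : socle_free -> exists2 z, z \in mx & nzd z A.
Proof.
move=> sf; have [us [hus cover]] := maxann_finite.
have [z zm zus] : exists2 z, z \in mx & forall u, u \in us -> z \notin colon A u.
  elim: (us) hus => [|u l IH] hl; first by exists 0; rewrite ?idealr0.
  have [|z zm zl] := IH; first by move=> w wl; apply: hl; rewrite inE wl orbT.
  have [zu|zu] := boolP (z \in colon A u); last first.
    by exists z => // w; rewrite inE => /orP[/eqP->|/zl].
  have mu := hl u (mem_head _ _).
  have [a am au] : exists2 a, a \in mx & a \notin colon A u.
    apply: contrapT => no; case: mu => /negP[]; apply: sf => a am.
    by rewrite -colonE; apply/negPn/negP => au; apply: no; exists a.
  (* Otherwise some [colon A w] with [w] in [l] lies in [colon A u]. Maximality makes the two equal,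
     so [z] would lie in [colon A w], against its choice. *)
  have [y yl yu] : exists2 y : R, (forall w, w \in l -> y \in colon A w) & y \notin colon A u.
    apply: contrapT => no; have [|w wl wu] := @maxann_inter_sub u l mu.
      by move=> b hb; apply/negPn/negP => bu; apply: no; exists b.
    have mw : maxann A w by apply: hl; rewrite inE wl orbT.
    by have := zl _ wl; rewrite (mw.2 _ mu.1 wu).
  (* The correction leaves [z] unchanged modulo the earlier ideals and moves it out of [colon A u],
     which is prime and contains neither [a] nor [y]. *)
  exists (z + a * y); first by rewrite rpredD // mulrC idealr_mull.
  move=> w; rewrite inE => /orP[/eqP->|wl]; apply/negP => h.
    have : a * y \in colon A u.
      by rewrite -(addKr z (a * y)); exact: (@rpredD _ (colon A u) (- z : R^o) _ (rpredNr zu) h).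
    by move=> /(maxann_prime mu)[h'|h']; [rewrite h' in au|rewrite h' in yu].
  case/negP: (zl _ wl); rewrite -(addrK (a * y) z).
  exact: (@rpredB _ (colon A w) (z + a * y : R^o) _ h (submod_mull _ (yl _ wl))).
exists z => // y zy; apply/negPn/negP => /[dup] yA /maxann_exists[v mv yv].
have [u uus vu] := cover v mv.
by have := zus u uus; rewrite (vu _ (yv _ _)) // colonE.
Qed.

End Avoidance.

Lemma nzd_socle_free M (A : submod M) a : a \in mx -> nzd a A -> socle_free A.
Proof. by move=> am aA u uA; apply/aA/uA. Qed.

(** A single element must serve two modules, so the search is run on their product. *)
Lemma exists_nzd2 M N (A : submod M) (B : submod N) :
  fg (fullm M) -> fg (fullm N) -> socle_free A -> socle_free B ->
  exists2 z, z \in mx & nzd z A /\ nzd z B.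
Proof.
move=> fM fN sA sB; have [|z zm zAB] := @exists_nzd _ (fg_prod fM fN) (prodm A B).
  move=> [u v] h; apply/prodmP; split=> /=.
    by apply: sA => a am; have /prodmP[] := h a am.
  by apply: sB => a am; have /prodmP[] := h a am.
exists z => //; split=> y zy.
  have /prodmP[] // : (y, 0) \in prodm A B.
  by apply: zAB; apply/prodmP; rewrite /= scaler0 rpred0.
have /prodmP[] // : (0, y) \in prodm A B.
by apply: zAB; apply/prodmP; rewrite /= scaler0 rpred0.
Qed.

Section Step.
Variables (M : lmodType R) (fM : fg (fullm M)).

Lemma nakayama_sub (A B : submod M) :
  (forall y, y \in B -> exists2 z, z \in mulm mx B & y - z \in A) ->
  {subset B <= A}.
Proof.
by have [s ->] := noeth_fg_mod nR fM B; exact: nakayama.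
Qed.

(** Regular sequences in a local ring can be permuted. If w u lies in A then u is x v modulo A,
    where w v is again in A, so Nakayama forces all such u into A. *)
Lemma nzd_swap (A : submod M) x w : x \in mx -> nzd x A -> nzd w (consm x A) ->
  nzd w A /\ nzd x (consm w A).
Proof.
move=> xm xA wxA; split.
  suff h : {subset comapm (mklin (@scale_is_linear _ M w)) A <= A}.
    by move=> u wu; apply: h; rewrite comapmE.
  apply: nakayama_sub => u; rewrite comapmE mklinE => wu.
  have /consmP[v uv] := wxA u (consm_sub x wu).
  exists (x *: v) => //; apply: mulm_mem => //; rewrite comapmE mklinE.
  apply: xA; rewrite scalerA mulrC -scalerA -(subKr (w *: u) (w *: (x *: v))).
  by rewrite -scalerBr rpredB // rpredZ.
move=> u /consmP[v xuv].
have /consmP[t vt] : v \in consm x A.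
  apply: wxA; apply/consmP; exists u.
  by rewrite -opprB rpredN.
apply/consmP; exists t; apply: xA.
have -> : x *: (u - w *: t) = (x *: u - w *: v) + w *: (v - x *: t).
  by rewrite !scalerBr addrA subrK !scalerA mulrC.
by rewrite rpredD ?rpredZ.
Qed.

(* Kaplansky's exchange argument: a socle element of M / (A + zM) would give one
   of M / (A + xM), which y forbids. *)
Lemma socle_swap (A : submod M) x y z : x \in mx -> y \in mx -> nzd x A ->
  nzd y (consm x A) -> nzd z A -> socle_free (consm z A).
Proof.
move=> xm ym xA yxA zA u uz.
have /consmP[v xuv] := uz x xm; have /consmP[w yuw] := uz y ym.
have /consmP[t vt] : v \in consm x A.
  apply: yxA; apply/consmP; exists w; apply: zA.
  have -> : z *: (y *: v - x *: w)
      = x *: (y *: u - z *: w) - y *: (x *: u - z *: v).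
    rewrite !scalerBr !scalerA (mulrC y x) opprB [RHS]addrC addrA subrK.
    by rewrite (mulrC z y) (mulrC z x).
  by rewrite rpredB ?rpredZ.
apply/consmP; exists t; apply: xA.
have -> : x *: (u - z *: t) = (x *: u - z *: v) + z *: (v - x *: t).
  by rewrite !scalerBr addrA subrK !scalerA mulrC.
by rewrite rpredD ?rpredZ.
Qed.

(** The start of a regular sequence may be exchanged for any nonzerodivisor [z] of [mx]: [x] and [z]
    are compared through a common [w] that is regular after either, and two uses of the induction
    hypothesis connect them. *)
Lemma depth_ge_consm d (A : submod M) z : depth_ge d.+1 A -> z \in mx ->
  nzd z A -> depth_ge d (consm z A).
Proof.
elim: d A z => [|d IH] A z [x xm [xA]].
  move=> [y yxA] zm zA; apply: contrapT => no.
  have full w : w \in consm z A by apply/negPn/negP => h; apply: no; exists w.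
  have : {subset fullm M <= A}.
    apply: nakayama_sub => w _; have /consmP[t wt] := full w.
    by exists (z *: t) => //; exact: mulm_mem.
  by move=> /(_ y isT)/(consm_sub x) h; rewrite h in yxA.
move=> dxA zm zA; have [y ym [yxA _]] := dxA.
have [||w wm [wz wx]] := @exists_nzd2 _ _ (consm z A) (consm x A) fM fM.
- exact: socle_swap yxA zA.
- exact: nzd_socle_free ym yxA.
have [_ xw] := nzd_swap xm xA wx.
have [_ zw] := nzd_swap zm zA wz.
exists w => //; split=> //; rewrite consmC; apply: (IH) => //.
by exists x => //; split=> //; rewrite consmC; exact: IH.
Qed.

End Step.

(** A common nonzerodivisor of the two ends cuts the whole sequence. That restriction to N commutes
    with adding zK holds because [z] is regular on M / p(C). *)
Lemma depth_ge_exact N K M (i : {linear N -> K}) (p : {linear K -> M}) d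
    (C : submod K) : (forall y, exists x, p x = y) ->
  (forall x, p x = 0 <-> exists n, x = i n) ->
  fg (fullm N) -> fg (fullm M) ->
  depth_ge d (comapm i C) -> depth_ge d (mapm p C) -> depth_ge d C.
Proof.
move=> ps ip fN fM; elim: d C => [|d IH] C.
  by move=> [y]; rewrite comapmE => yC _; exists (i y).
move=> dA dD; have [[a am [aA _]] [b bm [bD _]]] := (dA, dD).
have [z zm [zA zD]] := exists_nzd2 fN fM (nzd_socle_free am aA) (nzd_socle_free bm bD).
have pi0 n : p (i n) = 0 by apply/ip; exists n.
exists z => //; split=> [y zy|].
  have /mapmP[c cC pyc] : p y \in mapm p C.
    by apply: zD; rewrite -linearZ; exact: mem_mapm.
  have [|n ync] := (ip (y - c)).1; first by rewrite linearB pyc subrr.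
  rewrite -(subrK c y) rpredD // ync -comapmE; apply: zA.
  by rewrite comapmE linearZ /= -ync scalerBr rpredB // rpredZ.
apply: IH.
  have -> : comapm i (consm z C) = consm z (comapm i C); last exact: depth_ge_consm.
  apply: submod_anti => n; last first.
    move=> /consmP[n']; rewrite !comapmE linearB linearZ /= => h.
    by apply/consmP; exists (i n').
  rewrite comapmE => /consmP[y nzy].
  have /mapmP[c cC pyc] : p y \in mapm p C.
    apply: zD; rewrite -linearZ; apply/mapmP; exists (z *: y - i n).
      by rewrite -opprB rpredN.
    by rewrite linearB pi0 subr0.
  have [|n' ync] := (ip (y - c)).1; first by rewrite linearB pyc subrr.
  apply/consmP; exists n'; rewrite comapmE linearB linearZ /= -ync.
  have -> : i n - z *: (y - c) = (i n - z *: y) + z *: c.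
    by rewrite scalerBr opprB addrA addrAC.
  by rewrite rpredD ?rpredZ.
have -> : mapm p (consm z C) = consm z (mapm p C); last exact: depth_ge_consm.
apply: submod_anti => m.
  move=> /mapmP[y /consmP[t yt] ->]; apply/consmP; exists (p t).
  by rewrite -linearZ -linearB mem_mapm.
move=> /consmP[m' /mapmP[c cC mm]]; have [t tm'] := ps m'.
apply/mapmP; exists (c + z *: t); last by rewrite linearD linearZ /= tm' -mm subrK.
by apply/consmP; exists t; rewrite addrK.
Qed.

(** Bounds depth by dimension. The clause on annihilators serves the induction: applied to A + xM it
    places [x] in the lowest prime, below which one more prime is then found. *)
Lemma depth_ge_primes M d (A : submod M) : depth_ge d A ->
  exists p : nat -> prime_idealr R,
    (forall i, (i < d)%N -> proper_sub (p i) (p i.+1)) /\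
    forall a, (forall y : M, a *: y \in A) -> a \in p 0%N.
Proof.
elim: d A => [|d IH] A.
  move=> [y yA].
  have [||a aI a1|p [Ip _]] := @prime_avoiding _ nR (colon A y) (fun a => a = 1).
  - by [].
  - by move=> a b -> ->; rewrite mulr1.
  - by move: aI; rewrite a1 colonE scale1r (negPf yA).
  exists (fun=> p); split=> // a ha; apply: Ip; rewrite colonE; exact: ha.
move=> [x xm [xA /IH[p [pc px]]]].
have I0 : forall y : M, (0 : R) *: y \in A by move=> y; rewrite scale0r rpred0.
have IZD (c : R) (a b : R^o) : (forall y : M, (a : R) *: y \in A) ->
    (forall y : M, (b : R) *: y \in A) -> forall y : M, (c * a + b) *: y \in A.
  move=> ha hb y; rewrite scalerDl -[(c * a) *: y]scalerA; apply: rpredD;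
    [exact: rpredZ (ha y)|exact: hb].
(* A prime over Ann (M / A) avoiding the x^k s with s outside p 0 lies strictly
   below p 0, since x is a nonzerodivisor on M / A and belongs to p 0. *)
pose S a := exists k s, s \notin p 0%N /\ a = x ^+ k * s.
have p1 : 1 \notin p 0%N by rewrite idealr1.
have [||a aI [k [s [sp aE]]]|q [Iq qS]] := @prime_avoiding _ nR (mksub I0 IZD) S.
- by exists 0%N, 1; split=> //; rewrite mulr1.
- move=> a b [k [s [sp ->]]] [l [t [tp ->]]]; exists (k + l)%N, (s * t).
  by rewrite prime_idealrM negb_or sp tp exprD mulrACA.
- move: aI => /(mksubP I0 IZD) aI; case/negP: sp; apply: px => y.
  apply: consm_sub; have := aI y; rewrite aE; elim: k {aE} => [|k IHk].
    by rewrite mul1r.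
  by rewrite exprS -mulrA -scalerA => /xA/IHk.
exists (fun i => if i is j.+1 then p j else q); split=> [[_|i /pc//]|a aA].
  split=> [a aq|pq].
    apply/negPn/negP => ap; apply: (qS a aq); exists 0%N, a.
    by rewrite mul1r.
  have : x \in q by apply/pq/px => y; exact: consm_scale.
  by move=> /qS; apply; exists 1%N, 1; rewrite mulr1.
by apply/Iq/(mksubP I0 IZD).
Qed.

Lemma is_MCM_exact N K M (i : {linear N -> K}) (p : {linear K -> M}) :
  short_exact i p -> is_MCM mx N -> is_MCM mx M -> is_MCM mx K.
Proof.
move=> [ij ps ip] [/fin_genP fN [d [kd [dN _]]]] [/fin_genP fM [d' [kd' [dM _]]]].
have dd : d' = d := is_max_uniq kd' kd.
have fK : fg (fullm K) by exact: (fg_exact ps (fun x => (ip x).1) fN fM).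
split; first exact/fin_genP.
exists d; split=> //; split.
  apply/depth_geP; apply: (depth_ge_exact ps ip) => //.
    by rewrite comapm_zero //; apply/depth_geP.
  by rewrite mapm_zero -dd; apply/depth_geP.
move=> k /depth_geP/depth_ge_primes[q [qc _]]; apply: kd.2.
by exists q.
Qed.

End Depth.

(** * Multiplicity *)

Section Limits.
Local Open Scope classical_set_scope.

Lemma cvg_ratio_shift (c : nat) :
  (fun j : nat => j%:R / (j + c.+1)%:R : rat^o) @ \oo --> (1 : rat^o).
Proof.
have -> : (fun j : nat => j%:R / (j + c.+1)%:R : rat^o) =
    (fun j => 1 - c.+1%:R * (harmonic (j + c)%N : rat^o)).
  apply: funext => j; rewrite /harmonic /= -addnS.
  have jc : ((j + c.+1)%:R : rat) != 0 by rewrite pnatr_eq0 addnS.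
  apply: (mulIf jc); rewrite mulfVK // mulrBl mulfVK // mul1r natrD.
  by rewrite addrK.
rewrite -[X in _ --> X](subr0 (1 : rat^o)) -[X in _ - X](mulr0 (c.+1%:R : rat^o)).
apply: cvgB; first exact: cvg_cst.
apply: cvgM; first exact: cvg_cst.
have := @cvg_shiftn c rat^o (harmonic : nat -> rat^o) (nbhs (0 : rat^o)).
by move=> ->; exact: cvg_harmonic.
Qed.

Lemma cvg_expr_rat (u : nat -> rat^o) (a : rat^o) d : u @ \oo --> a ->
  (fun j => u j ^+ d : rat^o) @ \oo --> (a ^+ d : rat^o).
Proof.
move=> ua; elim: d => [|d IH]; first exact: cvg_cst.
have -> : (fun j => u j ^+ d.+1 : rat^o) = (fun j => u j * u j ^+ d).
  by apply: funext => j; rewrite exprS.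
by rewrite exprS; exact: cvgM.
Qed.

(** To be used with [l] the lengths of N / m^k N and [t] those of N modulo the trace of m^k K. The
    shift comes from Artin-Rees and is invisible in the limit; taking [c.+1] keeps the shifted
    denominators nonzero. *)
Lemma cvg_sandwich (d c n : nat) (l t : nat -> nat) :
  (forall k, (t k <= l k)%N) -> (forall k, (l k <= t (k + c.+1))%N) ->
  (fun k => (d`! * l k)%:R / (k ^ d)%:R : rat^o) @ \oo --> (n%:R : rat^o) ->
  (fun k => (d`! * t k)%:R / (k ^ d)%:R : rat^o) @ \oo --> (n%:R : rat^o).
Proof.
move=> tl lt hl.
have <- := @cvg_shiftn c.+1 rat^o (fun k => (d`! * t k)%:R / (k ^ d)%:R : rat^o)
  (nbhs (n%:R : rat^o)).
apply: (@squeeze_cvgr _ _ _ _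
  (fun j => ((d`! * l j)%:R / (j ^ d)%:R) * (j%:R / (j + c.+1)%:R) ^+ d : rat)
  (fun j => (d`! * l (j + c.+1)%N)%:R / ((j + c.+1) ^ d)%:R : rat)).
- exists 1%N => // j /= j1.
  have jd : (0 : rat) < (j ^ d)%:R by rewrite ltr0n expn_gt0 j1.
  have jcd : (0 : rat) < ((j + c.+1) ^ d)%:R.
    by rewrite ltr0n expn_gt0 addnS.
  apply/andP; split; last first.
    by rewrite ler_pM2r ?invr_gt0 // ler_nat leq_mul2l tl orbT.
  rewrite expr_div_n -!natrX mulrA mulfVK ?gt_eqF //.
  by rewrite ler_pM2r ?invr_gt0 // ler_nat leq_mul2l lt orbT.
- rewrite -[X in _ --> X](mulr1 (n%:R : rat^o)) -[X in _ * X](expr1n rat^o d).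
  by apply: cvgM => //; apply: cvg_expr_rat; exact: cvg_ratio_shift.
- by have -> := @cvg_shiftn c.+1 rat^o (fun k => (d`! * l k)%:R / (k ^ d)%:R : rat^o)
    (nbhs (n%:R : rat^o)).
Qed.

End Limits.

Section Multiplicity.
Variables (R : comNzRingType) (mx : idealr R).
Hypothesis nR : noeth_mod R^o.

Lemma rlen_mono (M : lmodType R) (A B : submod M) a : {subset A <= B} ->
  rlen A a -> exists2 b, (b <= a)%N & rlen B b.
Proof.
move=> AB [_ amax].
have h k : rchain B k -> (k <= a)%N.
  move=> [X [C [C0 Ck Cp]]]; apply: amax; exists X, C; split=> // x /AB; exact: C0.
by have [b hb] := rlen_bounded h; exists b => //; apply: h; exact: hb.1.
Qed.

Lemma has_length_powm (M : lmodType R) k n :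
  has_length (quotm (mulm (ideal_pow mx k) (fullm M))) n <->
  has_length (quotm (powm mx k (fullm M)) : lmodType R) n.
Proof. by rewrite -mulm_ideal_pow. Qed.

(** The length of K / m^k K is that of M / m^k M plus that of N modulo the trace of m^k K. This
    trace contains m^k N, and by Artin-Rees its term at k + c + 1 lies in m^k N, so the lengths on N
    have the same leading growth. *)
Lemma has_multiplicity_exact (N K M : lmodType R)
    (i : {linear N -> K}) (p : {linear K -> M}) m n : short_exact i p -> fin_gen N -> fin_gen M ->
  has_multiplicity mx M m -> has_multiplicity mx N n ->
  has_multiplicity mx K (m + n).
Proof.
move=> [ij ps ip] /fin_genP fN /fin_genP fM [d [lM [kd hM cM]]] [d' [lN [kd' hN cN]]].
have dd : d' = d := is_max_uniq kd' kd; rewrite {}dd {kd'} in cN.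
have fK : fg (fullm K) by exact: (fg_exact ps (fun x => (ip x).1) fN fM).
have rM k : rlen (powm mx k (fullm M)) (lM k).
  by apply/has_length_quotm/has_length_powm; exact: hM.
have rN k : rlen (powm mx k (fullm N)) (lN k).
  by apply/has_length_quotm/has_length_powm; exact: hN.
pose A k := comapm i (powm mx k (fullm K)).
have NA k : {subset powm mx k (fullm N) <= A k}.
  move=> x xk; rewrite comapmE.
  have : i x \in powm mx k (mapm i (fullm N)) by rewrite -mapm_powm; exact: mem_mapm.
  exact: mulm_mono.
have ext k : exists b, (b <= lN k)%N /\ rlen (A k) b.
  by have [b bl hb] := rlen_mono (NA k) (rN k); exists b.
have [t ht] := choice ext.
have [c hc] := artin_rees mx nR (mapm i (fullm N)) fK.
have AN k : {subset A (k + c.+1)%N <= powm mx k (fullm N)}.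
  move=> x; rewrite comapmE => xk.
  have : i x \in powm mx k (mapm i (fullm N)).
    apply: hc; last exact: mem_mapm.
    apply: mulm_mono xk => //; apply: ideal_pow_mono.
    by rewrite leq_add2l.
  by rewrite -mapm_powm => /mapmP[y yk /ij->].
have lt k : (lN k <= t (k + c.+1))%N.
  have [b bl hb] := rlen_mono (AN k) (ht _).2.
  by rewrite (is_max_uniq (rN k) hb).
exists d, (fun k => t k + lM k)%N; split=> // [k|].
  apply/has_length_powm/has_length_quotm.
  apply: (rlen_exact ps ip); first exact: (ht k).2.
  rewrite mapm_powm; have -> : mapm p (fullm K) = fullm M; last exact: rM.
  apply: submod_anti => // y _; have [x <-] := ps y; exact: mem_mapm.
have -> : (fun k => (d`! * (t k + lM k))%:R / (k ^ d)%:R : rat^o) =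
    (fun k => (d`! * lM k)%:R / (k ^ d)%:R + (d`! * t k)%:R / (k ^ d)%:R : rat^o).
  by apply: funext => k; rewrite mulnDr natrD mulrDl addrC.
rewrite natrD; apply: cvgD; first exact: cM.
exact: cvg_sandwich (fun k => (ht k).1) lt cN.
Qed.

End Multiplicity.

(** * Extensions as pushouts *)

Section Descent.
Variables (R : comNzRingType) (V M : lmodType R) (A : submod V).

Lemma descend (f : {linear V -> M}) : (forall x, x \in A -> f x = 0) ->
  exists h : {linear quotm A -> M}, forall x, h (quotm_pi A x) = f x.
Proof.
move=> fA; have [r rP] := choice (@quotm_surj _ _ A).
have fr x : f (r (quotm_pi A x)) = f x.
  apply/eqP; rewrite -subr_eq0 -linearB; apply/eqP/fA.
  by apply/quotm_piP; rewrite rP.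
have hl : linear (fun y => f (r y)).
  by move=> c y z; rewrite -{1}(rP y) -{1}(rP z) -linearP fr linearP.
by exists (mklin hl) => x; rewrite mklinE fr.
Qed.

End Descent.

(** * Lengths of Hom into a fixed module *)

Section Hom.
Variables (R : comNzRingType) (T : lmodType R).
Implicit Types K L M N : lmodType R.

Lemma homm0 K : linear (0 : K -> T).
Proof. by move=> c x y; rewrite -[RHS]/(c *: 0 + 0) scaler0 addr0. Qed.
Lemma hommZD K (c : R) (f g : K -> T) : linear f -> linear g ->
  linear (c *: f + g).
Proof.
move=> lf lg a x y; rewrite -[LHS]/(c *: f _ + g _).
rewrite -[RHS]/(a *: (c *: f x + g x) + (c *: f y + g y)) lf lg !scalerDr !scalerA mulrC -!addrA.
by congr (_ + _); rewrite addrCA.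
Qed.
Definition homm K : submod (K -> T) := mksub (@homm0 K) (@hommZD K).
Lemma hommP K (f : K -> T) : reflect (linear f) (f \in homm K).
Proof. exact: mksubP. Qed.
Lemma homm_lin K (f : {linear K -> T}) : (f : K -> T) \in homm K.
Proof. by apply/hommP; exact: linearP. Qed.

Lemma precomp_exists K L (h : {linear K -> L}) :
  exists P : {linear subm_type (homm L) -> subm_type (homm K)},
    forall f x, submv _ (P f) x = submv _ f (h x).
Proof.
have l : linear (fun f : subm_type (homm L) => (submv _ f \o h : K -> T)).
  by move=> c f g; apply: funext => x; rewrite -[LHS]/(submv _ (c *: f + g) (h x)) linearP.
have [|P PE] := @corestrict _ _ _ (mklin l) (homm K).
  move=> f; apply/hommP => c x y; rewrite mklinE.
  rewrite -[LHS]/(submv _ f (h (c *: x + y))) linearP.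
  exact: (elimT (hommP _) (submvP f)).
by exists P => f x; rewrite PE.
Qed.

Definition homm_map K (f : subm_type (homm K)) : {linear K -> T} :=
  mklin (elimT (hommP _) (submvP f)).
Lemma homm_mapE K (f : subm_type (homm K)) x : submv _ f x = homm_map f x.
Proof. by []. Qed.

Lemma homm_ext K (f g : subm_type (homm K)) :
  (forall x, submv _ f x = submv _ g x) -> f = g.
Proof. by move=> fg; apply: submv_inj; apply: funext. Qed.

Lemma has_length_homm_iso K L n : isomorphic K L ->
  has_length (subm_type (homm K)) n -> has_length (subm_type (homm L)) n.
Proof.
move=> [f [g fK gK]].
have gl : linear g.
  by move=> c x y; apply: (can_inj fK); rewrite gK linearP !gK.
have [F FE] := precomp_exists f; have [G GE] := precomp_exists (mklin gl).
apply: (has_length_bij (f := G)); exists F => h; apply: homm_ext => x.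
  by rewrite FE GE mklinE fK.
by rewrite GE FE mklinE gK.
Qed.

Lemma finite_length_homm K : fg (fullm K) -> finite_length T ->
  finite_length (subm_type (homm K)).
Proof.
move=> [s sE] hT.
have l : linear (fun f : subm_type (homm K) => (fun i : 'I_(size s) => submv _ f s`_i : T)).
  by move=> c f g; apply: funext => x; rewrite -[LHS]/(submv _ (c *: f + g) s`_x) linearP.
apply: (finite_length_inj (f := mklin l)); last exact: finite_length_pow.
move=> f g fg; apply: homm_ext => x.
have : x \in span s by rewrite -sE.
move=> /span_sum[c ->].
rewrite !homm_mapE !linear_sum; apply: eq_bigr => i _; rewrite !linearZ -!homm_mapE.
by congr (_ *: _); exact: (congr1 (fun h => h i) fg).
Qed.

Variables (N K M : lmodType R) (i : {linear N -> K}) (p : {linear K -> M}).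

Lemma extm0 : exists B : {linear K -> T}, forall n, B (i n) = (0 : N -> T) n.
Proof. by exists (\0 : {linear K -> T}). Qed.
Lemma extmZD (c : R) (a b : N -> T) :
  (exists B : {linear K -> T}, forall n, B (i n) = a n) ->
  (exists B : {linear K -> T}, forall n, B (i n) = b n) ->
  exists B : {linear K -> T}, forall n, B (i n) = (c *: a + b) n.
Proof.
move=> [u ua] [v vb]; exists ((c \*: u) \+ v : {linear K -> T}) => n.
by rewrite /= ua vb.
Qed.
(** The image of restriction from Hom(K, T), taken inside all functions on N so that the images for
    two different K can be compared. *)
Definition extm : submod (N -> T) := mksub extm0 extmZD.
Lemma extmP (a : N -> T) :
  reflect (exists B : {linear K -> T}, forall n, B (i n) = a n) (a \in extm).
Proof. exact: mksubP. Qed.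

Lemma homm_short_exact : short_exact i p ->
  exists (u : {linear subm_type (homm M) -> subm_type (homm K)})
    (v : {linear subm_type (homm K) -> subm_type extm}), short_exact u v.
Proof.
move=> [ij ps ip]; have [P PE] := precomp_exists p.
have l : linear (fun f : subm_type (homm K) => (submv _ f \o i : N -> T)).
  by move=> c f g; apply: funext => x; rewrite -[LHS]/(submv _ (c *: f + g) (i x)) linearP.
have [|v vE] := @corestrict _ _ _ (mklin l) extm.
  by move=> f; apply/extmP; exists (homm_map f).
exists P, v; split=> [f g fg|b|f].
- apply: homm_ext => y; have [x <-] := ps y.
  by rewrite -!PE fg.
- have /extmP[B BE] := submvP b.
  exists (Sub (B : K -> T) (homm_lin B)); apply: submv_inj; rewrite vE.
  by apply: funext => n; rewrite -[LHS]/(B (i n)) BE.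
- split=> [vf0|[g ->]]; last first.
    apply: submv_inj; rewrite vE linear0; apply: funext => n.
    rewrite -[LHS]/(submv _ (P g) (i n)) PE.
    have -> : p (i n) = 0 by apply/ip; exists n.
    by rewrite homm_mapE linear0.
  have fi n : submv _ f (i n) = 0.
    by have := congr1 (fun b => submv _ b n) vf0; rewrite vE linear0.
  pose fl := homm_map f.
  have [r rP] := choice ps.
  have fr x : fl (r (p x)) = fl x.
    apply/eqP; rewrite -subr_eq0 -linearB; apply/eqP.
    have [|n ->] := (ip (r (p x) - x)).1; first by rewrite linearB rP subrr.
    exact: fi.
  have hl : linear (fun y => fl (r y)).
    by move=> c y z; rewrite -{1}(rP y) -{1}(rP z) -linearP fr linearP.
  exists (Sub (fun y => fl (r y)) (introT (hommP _) hl)).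
  by apply: homm_ext => x; rewrite PE -[RHS]/(fl (r (p x))) fr.
Qed.

End Hom.

Section FreeModule.
Variables (R : comNzRingType) (q : nat) (M : lmodType R).

Lemma lincomb_linear (y : 'I_q -> M) :
  linear (fun v : 'rV[R]_q => \sum_j v 0 j *: y j).
Proof.
move=> c u v; rewrite scaler_sumr -big_split; apply: eq_bigr => j _.
by rewrite !mxE scalerDl scalerA.
Qed.
Definition lincomb (y : 'I_q -> M) : {linear 'rV[R]_q -> M} :=
  mklin (lincomb_linear y).

End FreeModule.
Arguments lincomb {R q M} y.

Section FgFree.
Variable R : comNzRingType.

Lemma rV_lift q (M N : lmodType R) (f : {linear N -> M}) (b : {linear 'rV[R]_q -> M}) :
  (forall y, exists x, f x = y) ->
  exists g : {linear 'rV[R]_q -> N}, forall v, f (g v) = b v.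
Proof.
move=> fs; have [r rP] := choice fs.
exists (lincomb (fun j => r (b (delta_mx 0 j)))) => v.
rewrite mklinE [in RHS](row_sum_delta v) !linear_sum; apply: eq_bigr => j _.
by rewrite !linearZ /= rP.
Qed.

Lemma fg_rV q : fg (fullm ('rV[R]_q : lmodType R)).
Proof.
exists [seq (delta_mx 0 j) | j <- enum 'I_q]; apply: submod_anti => // w _.
rewrite (row_sum_delta w); apply: rpred_sum => j _; apply: rpredZ.
by apply: mem_span; rewrite map_f // mem_enum.
Qed.

Lemma fg_pow (N : lmodType R) l : fg (fullm N) -> fg (fullm ('I_l -> N)).
Proof.
move=> fN; elim: l => [|l IH]; last first.
  have [i [p [_ ps ip]]] := short_exact_pow_cons N l.
  exact: (fg_exact ps (fun x => (ip x).1) fN IH).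
exists [::]; apply: submod_anti => // x _; apply/zeromP.
by apply: funext => -[].
Qed.

Lemma powm_pow (mx : idealr R) (N : lmodType R) k l (t : 'I_l -> N) :
  (forall j, t j \in powm mx k (fullm N)) -> t \in powm mx k (fullm ('I_l -> N)).
Proof.
move=> tk.
have sl j : linear (fun n : N => (fun j' : 'I_l => if j' == j then n else 0) : 'I_l -> N).
  move=> c x y; apply: funext => j'; rewrite !fctE.
  by case: eqP => _ //; rewrite scaler0 addr0.
have -> : t = \sum_j mklin (sl j) (t j).
  apply: funext => j; rewrite fct_sumE (bigD1 j) //= eqxx big1 ?addr0 // => j' jj'.
  by rewrite eq_sym (negPf jj').
apply: rpred_sum => j _.
have : mklin (sl j) (t j) \in powm mx k (mapm (mklin (sl j)) (fullm N)).
  by rewrite -mapm_powm; exact: mem_mapm.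
exact: mulm_mono.
Qed.

End FgFree.

(** * The extension attached to a map on the kernel of a cover *)

Section Pushout.
Variables (R : comNzRingType) (F M N : lmodType R) (pF : {linear F -> M}).

(* g represents a linear map on the kernel of pF; its other values are junk. *)
Definition lin_on (g : F -> N) := forall c u v, pF u = 0 -> pF v = 0 ->
  g (c *: u + v) = c *: g u + g v.

Lemma lin_on0 g : lin_on g -> g 0 = 0.
Proof.
move=> lg; have := lg 1 0 0 (linear0 _) (linear0 _).
by rewrite !scale1r addr0 => /eqP; rewrite -subr_eq0 opprD addrA subrr sub0r oppr_eq0 => /eqP.
Qed.

Lemma lin_on_gen g (zs : seq F) (G : {linear F -> N}) : lin_on g ->
  comapm pF (zerom M) = span zs -> (forall z, z \in zs -> G z = g z) ->
  forall v, pF v = 0 -> G v = g v.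
Proof.
move=> lg zsE Gg v pv.
have E0 : pF 0 = 0 /\ G 0 = g 0 by rewrite !linear0 lin_on0.
have EZD (c : R) x y : pF x = 0 /\ G x = g x -> pF y = 0 /\ G y = g y ->
    pF (c *: x + y) = 0 /\ G (c *: x + y) = g (c *: x + y).
  by move=> [px gx] [py gy]; rewrite !linearP px py gx gy lg // scaler0 addr0.
have : v \in comapm pF (zerom M) by rewrite comapmE; apply/zeromP.
rewrite zsE => vz.
suff h : {subset span zs <= mksub E0 EZD} by have /(mksubP E0 EZD)[] := h v vz.
apply: span_sub => z zzs; apply/(mksubP E0 EZD); split; last exact: Gg.
have : z \in comapm pF (zerom M) by rewrite zsE mem_span.
by rewrite comapmE => /zeromP.
Qed.

Lemma lin_onZ g (a : R) : lin_on g -> lin_on (fun v => a *: g v).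
Proof.
by move=> lg c u v pu pv; rewrite lg // scalerDr !scalerA mulrC.
Qed.

Section Construction.
Variables (g : F -> N) (lg : lin_on g).

Lemma push0 : pF (0 : N * F).2 = 0 /\ (0 : N * F).1 + g (0 : N * F).2 = 0.
Proof. by rewrite linear0 lin_on0 // addr0. Qed.
Lemma pushZD (c : R) (x y : N * F) : pF x.2 = 0 /\ x.1 + g x.2 = 0 ->
  pF y.2 = 0 /\ y.1 + g y.2 = 0 ->
  pF (c *: x + y).2 = 0 /\ (c *: x + y).1 + g (c *: x + y).2 = 0.
Proof.
move=> [px gx] [py gy]; split; first by rewrite linearP px py scaler0 addr0.
by rewrite /= lg // addrACA -scalerDr gx gy scaler0 addr0.
Qed.
(** The relations are the pairs (- g v, v) with v in the kernel of [pF]; they identify v with g v in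
    N. *)
Definition pushm : submod (N * F)%type := mksub push0 pushZD.
Lemma pushmP x : reflect (pF x.2 = 0 /\ x.1 + g x.2 = 0) (x \in pushm).
Proof. exact: mksubP. Qed.

Definition pushout : lmodType R := quotm pushm.

Definition push_i : {linear N -> pushout} := quotm_pi pushm \o mklin (@inl_linear R N F).

Lemma push_p_exists : exists p : {linear pushout -> M},
  forall x, p (quotm_pi pushm x) = pF x.2.
Proof.
have [|p pE] := @descend _ _ _ pushm (pF \o mklin (@snd_linear R N F) : {linear _ -> _}).
  by move=> x /pushmP[].
by exists p => x; rewrite pE.
Qed.

Lemma pushout_short_exact : (forall y, exists x, pF x = y) ->
  exists p : {linear pushout -> M}, short_exact push_i p.
Proof.
move=> pFs; have [p pE] := push_p_exists; exists p; split=> [n n'|y|x].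
- move=> /quotm_piP/pushmP[_ /=]; rewrite subr0 lin_on0 // addr0 => /eqP.
  by rewrite subr_eq0 => /eqP.
- by have [v <-] := pFs y; exists (quotm_pi pushm (0, v)); rewrite pE.
have [[n v] <-] := quotm_surj x; rewrite pE /=; split=> [pv|[n']].
  exists (n + g v); apply/quotm_piP/pushmP; rewrite /= subr0; split=> //.
  by rewrite opprD addrA subrr sub0r addNr.
by move=> /quotm_piP/pushmP[/=]; rewrite subr0.
Qed.

(** Universal property of the pushout. For a free F it says that [a] extends to the extension
    exactly when pushing forward along [a] kills the class of [g]. *)
Lemma pushout_ext (T : lmodType R) (a : {linear N -> T}) :
  (a : N -> T) \in extm T push_i <->
  exists b : {linear F -> T}, forall v, pF v = 0 -> b v = a (g v).
Proof.
split=> [/extmP[B BE]|[b bE]].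
  exists (B \o (quotm_pi pushm \o mklin (@inr_linear R N F)) : {linear F -> T}) => v pv.
  rewrite -BE /=; congr (B _); apply/quotm_piP/pushmP => /=.
  by rewrite subr0 sub0r addNr.
pose f : {linear (N * F)%type -> T} :=
  (a \o mklin (@fst_linear R N F)) \+ (b \o mklin (@snd_linear R N F)).
have [|B BE] := @descend _ _ _ pushm f.
  move=> x /pushmP[px gx]; rewrite /= bE // -linearD gx; exact: linear0.
by apply/extmP; exists B => n; rewrite /= BE /= linear0 addr0.
Qed.

End Construction.

Lemma pushout_eq (g g' : F -> N) (lg : lin_on g) (lg' : lin_on g') :
  g = g' -> pushout lg = pushout lg'.
Proof. by move=> e; case: _ / e in lg' *; rewrite (Prop_irrelevance lg lg'). Qed.

End Pushout.

(** * The Miyata-type criterion *)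

Section Core.
Variables (R : comNzRingType) (mx : idealr R).
Hypotheses (nR : noeth_mod R^o) (lR : local_ring mx).
Variables (q : nat) (M N : lmodType R) (pF : {linear 'rV[R]_q -> M}).
Hypothesis pFs : forall y, exists x, pF x = y.
Hypothesis fN : fg (fullm N).
Hypothesis lN : forall k, finite_length (quotm (powm mx k (fullm N)) : lmodType R).
Variables (g : 'rV[R]_q -> N) (lg : lin_on pF g).

Lemma fg_base : fg (fullm M).
Proof. exact: fg_full_surj pFs (fg_rV R q). Qed.

(* For T = N / m^k N, the image of Hom(E, T) -> Hom(N, T) has the same length for
   E = E_g and E = E_sg, and is contained in the second one: a linear map N -> T
   thus extends to E_g as soon as s times it does, and s is nilpotent on T. *)
Lemma ext_mod_pow (s : R) k : s \in mx ->
  isomorphic (pushout lg) (pushout (lin_onZ s lg)) ->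
  exists b : {linear 'rV[R]_q -> quotm (powm mx k (fullm N))},
    forall v, pF v = 0 -> b v = quotm_pi _ (g v).
Proof.
move=> sm iso; pose T : lmodType R := quotm (powm mx k (fullm N)).
have [p ex] := pushout_short_exact lg pFs.
have [p' ex'] := pushout_short_exact (lin_onZ s lg) pFs.
have fE : fg (fullm (pushout lg)).
  by have [_ ps ip] := ex; exact: (fg_exact ps (fun x => (ip x).1) fN fg_base).
have [e he] := finite_length_homm fE (lN k).
have he' := has_length_homm_iso iso he.
have [u [v uv]] := homm_short_exact T ex; have [u' [v' uv']] := homm_short_exact T ex'.
have [a [b [ha hb eab]]] := has_length_exact_inv uv he.
have [a' [b' [ha' hb' eab']]] := has_length_exact_inv uv' he'.
have bb' : b' = b.
  apply/eqP; rewrite -(eqn_add2l a) -eab eab'.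
  by rewrite (is_max_uniq ha ha').
rewrite bb' in hb'.
(* The direct inclusion is the opposite one, since [s] times a map that serves for [g] serves for s
   g. Equal finite lengths reverse it. *)
have sub : {subset extm T (push_i (lin_onZ s lg)) <= extm T (push_i lg)}.
  apply: has_length_subset hb hb' => f fE'.
  have /extmP[B BE] := fE'.
  have lf : linear f by move=> c x y; rewrite -!BE !linearP.
  have /(pushout_ext lg (mklin lf))[bb bbE] := fE'.
  apply/(pushout_ext (lin_onZ s lg) (mklin lf)).
  exists (s \*: bb : {linear _ -> _}) => w pw.
  by rewrite [LHS]/= bbE // linearZZ.
(* [P k] is zero, as s^k lies in m^k. Each use of [sub] then removes one factor [s], because s^(j+1)
   g is s^j applied to s g. *)
pose P j : {linear N -> T} := (s ^+ j) \*: (quotm_pi (powm mx k (fullm N))).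
have step j : (P j : N -> T) \in extm T (push_i lg) ->
    (P 0%N : N -> T) \in extm T (push_i lg).
  elim: j => // j IH /pushout_ext[b0 b0E]; apply/IH/sub/pushout_ext.
  exists b0 => w pw; rewrite b0E //= exprSr -scalerA; congr (_ *: _).
  by rewrite -linearZ.
have : (P 0%N : N -> T) \in extm T (push_i lg).
  apply: (step k); apply/pushout_ext; exists (\0 : {linear _ -> _}) => w _ /=.
  rewrite -linearZ; apply/esym/quotm_pi_eq0.
  by apply: mulm_mem => //; exact: pow_expr.
move=> /pushout_ext[b0 b0E]; exists b0 => w pw; rewrite b0E //=.
by rewrite expr0 scale1r.
Qed.

(** No limit of the incompatible maps is formed. Extending [g] amounts to membership of one tuple in
    a submodule of N^l, and lifting each map to N approximates this tuple up to m^k N^l. *)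
Lemma ext_of_mod_pow :
  (forall k, exists b : {linear 'rV[R]_q -> quotm (powm mx k (fullm N))},
    forall v, pF v = 0 -> b v = quotm_pi _ (g v)) ->
  exists G : {linear 'rV[R]_q -> N}, forall v, pF v = 0 -> G v = g v.
Proof.
move=> hb; have [zs zsE] := noeth_fg_mod nR (fg_rV R q) (comapm pF (zerom M)).
have zsP z : z \in zs -> pF z = 0.
  move=> zzs; have : z \in comapm pF (zerom M) by rewrite zsE mem_span.
  by rewrite comapmE => /zeromP.
pose l := size zs.
have B0 : exists G : {linear 'rV[R]_q -> N}, forall i, (0 : 'I_l -> N) i = G zs`_i.
  by exists (\0 : {linear _ -> _}).
have BZD (c : R) (t t' : 'I_l -> N) :
    (exists G : {linear 'rV[R]_q -> N}, forall i, t i = G zs`_i) ->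
    (exists G : {linear 'rV[R]_q -> N}, forall i, t' i = G zs`_i) ->
    exists G : {linear 'rV[R]_q -> N}, forall i, (c *: t + t') i = G zs`_i.
  move=> [G GE] [G' GE']; exists ((c \*: G) \+ G' : {linear _ -> _}) => i.
  by rewrite !fctE GE GE'.
pose t0 : 'I_l -> N := fun i => g zs`_i.
have : t0 \in mksub B0 BZD.
  apply: (krull_intersection nR lR (fg_pow l fN)) => k.
  have [b bE] := hb k; have [G GE] := rV_lift b (@quotm_surj _ _ _).
  apply/addmP; exists (fun i => G zs`_i); first by apply/(mksubP B0 BZD); exists G.
  apply: powm_pow => i; rewrite !fctE; apply/quotm_piP.
  by rewrite GE bE //; apply/zsP/mem_nth.
move=> /(mksubP B0 BZD)[G GE]; exists G => v pv.
apply: (lin_on_gen lg zsE) pv => z zzs.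
have iz : (index z zs < l)%N by rewrite index_mem.
by have := GE (Ordinal iz); rewrite /t0 /= nth_index.
Qed.

Lemma ext_of_iso (s : R) : s \in mx ->
  isomorphic (pushout lg) (pushout (lin_onZ s lg)) ->
  exists G : {linear 'rV[R]_q -> N}, forall v, pF v = 0 -> G v = g v.
Proof. by move=> sm iso; apply: ext_of_mod_pow => k; exact: ext_mod_pow sm iso. Qed.

End Core.

(** * Ext from a projective resolution *)

Section Isomorphic.
Variable R : comNzRingType.
Implicit Types K L M : lmodType R.

Lemma isomorphic_sym K L : isomorphic K L -> isomorphic L K.
Proof.
move=> [f [g fK gK]].
have gl : linear g.
  by move=> c x y; apply: (can_inj fK); rewrite gK linearP !gK.
by exists (mklin gl), f.
Qed.

Lemma isomorphic_trans K L M : isomorphic K L -> isomorphic L M -> isomorphic K M.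
Proof.
by move=> [f bf] [g bg]; exists (g \o f : {linear K -> M}); exact: bij_comp.
Qed.

End Isomorphic.

Section Resolution.
Variables (R : comNzRingType) (mx : idealr R) (M N : lmodType R).
Variable P : proj_resolution M.
Variables (q : nat) (pF : {linear 'rV[R]_q -> M}).
Hypothesis pFs : forall y, exists x, pF x = y.
Variable phi : {linear 'rV[R]_q -> P 0%N}.
Hypothesis phiE : forall v, res_aug P (phi v) = pF v.
Variable w : 'rV[R]_q -> P 1%N.
(* By exactness, w lifts phi along the differential on the syzygy of M. *)
Hypothesis wE : forall v, pF v = 0 -> res_diff P 0 (w v) = phi v.

Local Notation Z1 := (subm_type (cocycle1 P N)).

Lemma cocycle_linear (c : Z1) : linear (submv _ c).
Proof. by have /asboolP[] := submvP c. Qed.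

Definition cocycle_map (c : Z1) : {linear P 1%N -> N} := mklin (cocycle_linear c).

Lemma cocycle_mapE (c : Z1) x : submv _ c x = cocycle_map c x.
Proof. by []. Qed.

Lemma cocycle_diff (c : Z1) x y : res_diff P 0 x = res_diff P 0 y ->
  cocycle_map c x = cocycle_map c y.
Proof.
move=> xy; apply/eqP; rewrite -subr_eq0 -linearB; apply/eqP.
have [|z ->] := (@res_exactS _ _ P 0 (x - y)).1; first by rewrite linearB xy subrr.
by have /asboolP[_] := submvP c; apply.
Qed.

Definition syz_map (c : Z1) (v : 'rV[R]_q) : N := cocycle_map c (w v).

(** [w] is not assumed linear, but a cocycle depends only on the differential of its argument, and
    on the kernel of [pF] the differential of [w v] is [phi v]. *)
Lemma syz_map_lin (c : Z1) : lin_on pF (syz_map c).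
Proof.
move=> a u v pu pv; rewrite /syz_map -linearP; apply: cocycle_diff.
by rewrite linearP !wE // linearP ?pu ?pv ?scaler0 ?addr0.
Qed.

(** [P 0] is the image of the differential plus the image of [phi]. The cocycle on the first and [G]
    on the second agree on the overlap, which comes from the kernel of [pF], so they glue. *)
Lemma coboundary_of_ext (c : Z1) (G : {linear 'rV[R]_q -> N}) :
  (forall v, pF v = 0 -> G v = syz_map c v) -> c \in coboundary1 P N.
Proof.
move=> GE.
have dec (x : P 0%N) : exists yz : 'rV[R]_q * P 1%N,
    x = res_diff P 0 yz.2 + phi yz.1.
  have [y py] := pFs (res_aug P x).
  have [|z xz] := (@res_exact0 _ _ P (x - phi y)).1.
    by rewrite linearB phiE py subrr.
  by exists (y, z); rewrite /= -xz subrK.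
have [t tE] := choice dec.
pose g x := cocycle_map c (t x).2 + G (t x).1.
have gE y z : g (res_diff P 0 z + phi y) = cocycle_map c z + G y.
  rewrite /g; set x := res_diff P 0 z + phi y.
  have xE := tE x; rewrite {1}/x in xE.
  have d : res_diff P 0 (z - (t x).2) = phi ((t x).1 - y).
    rewrite !linearB; apply/eqP; rewrite subr_eq addrAC eq_sym subr_eq.
    by rewrite [X in X == _]addrC -xE.
  have p0 : pF ((t x).1 - y) = 0.
    rewrite -phiE -d; apply/(@res_exact0 _ _ P); by exists (z - (t x).2).
  have /eqP := GE _ p0; rewrite /syz_map (@cocycle_diff c _ (z - (t x).2)) ?wE //.
  by rewrite !linearB subr_eq addrAC eq_sym subr_eq [X in _ == X]addrC => /eqP->.
have gl : linear g.
  move=> a x y; rewrite {1}(tE x) {1}(tE y).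
  have -> : a *: (res_diff P 0 (t x).2 + phi (t x).1) + (res_diff P 0 (t y).2 + phi (t y).1)
     = res_diff P 0 (a *: (t x).2 + (t y).2) + phi (a *: (t x).1 + (t y).1).
    by rewrite !linearP scalerDr addrACA.
  by rewrite gE !linearP /g scalerDr addrACA.
apply/asboolP; exists (mklin gl); apply: funext => z.
rewrite -[LHS]/(cocycle_map c z) /= -[res_diff P 0 z]addr0.
by rewrite -(linear0 phi) gE linear0 addr0.
Qed.

Hypotheses (nR : noeth_mod R^o) (lR : local_ring mx) (fN : fg (fullm N)).

(** A class is determined by the values of its syzygy map at generators of the kernel, a tuple in a
    Noetherian power of N: when these values vanish, the zero map extends the syzygy map and the
    cocycle is a coboundary. *)
Lemma fg_Ext1 : fg (fullm (Ext1 P N)).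
Proof.
have [zs zsE] := noeth_fg_mod nR (fg_rV R q) (comapm pF (zerom M)).
have rl : linear (fun c : Z1 => (fun i : 'I_(size zs) => syz_map c zs`_i) : 'I_(size zs) -> N).
  move=> a c d; apply: funext => i; rewrite /syz_map -!cocycle_mapE.
  by rewrite -[LHS]/(submv _ (a *: c + d) (w zs`_i)) linearP.
pose rho := mklin rl.
have [s sE] := noeth_fg_mod nR (fg_pow (size zs) fN) (mapm rho (fullm _)).
have [cs csE] : exists cs : seq Z1, map rho cs = s.
  have : {subset s <= mapm rho (fullm _)} by rewrite sE; exact: mem_span.
  elim: s {sE} => [|x s IH] sA; first by exists [::].
  have [|cs csE] := IH; first by move=> y ys; apply: sA; rewrite inE ys orbT.
  have /mapmP[c _ cE] := sA x (mem_head _ _).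
  by exists (c :: cs); rewrite map_cons -cE csE.
exists (map (quotm_pi _) cs); apply: submod_anti => // e _.
have [c <-] := quotm_surj e.
have : rho c \in mapm rho (span cs) by rewrite mapm_span csE -sE; exact: mem_mapm.
move=> /mapmP[d ds cd].
have -> : quotm_pi (coboundary1 P N) c = quotm_pi (coboundary1 P N) d.
  apply/quotm_piP; apply: (@coboundary_of_ext _ (\0 : {linear _ -> _})).
  apply: (lin_on_gen (@syz_map_lin (c - d)) zsE) => z zz.
  have iz : (index z zs < size zs)%N by rewrite index_mem.
  have : rho (c - d) = 0 by rewrite linearB cd subrr.
  move=> /(congr1 (fun t => t (Ordinal iz))).
  by rewrite -[LHS]/(syz_map (c - d) zs`_(index z zs)) nth_index.
by rewrite -mapm_span; exact: mem_mapm.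
Qed.

Hypothesis lN : forall k, finite_length (quotm (powm mx k (fullm N)) : lmodType R).

Lemma Ext1_killed h (K : 'I_h -> lmodType R) :
  (forall g (lg : lin_on pF g), exists i, isomorphic (@pushout _ _ _ N _ g lg) (K i)) ->
  forall r, r \in ideal_pow mx h -> forall e : Ext1 P N, r *: e = 0.
Proof.
move=> hK r rh e; have [c <-] := quotm_surj e.
rewrite -linearZ; apply/quotm_pi_eq0.
suff : {subset ideal_pow mx h <= colon (coboundary1 P N) c}.
  by move=> /(_ r rh); rewrite colonE.
apply: ideal_pow_ind => s sh sm; rewrite colonE.
(* Prefix products for j = 0, ..., h, one more than there are classes. *)
pose a j : R := \prod_(b <- take j s) b.
have lg := @syz_map_lin c.
have [idx idxP] := choice (fun j : 'I_h.+1 => hK _ (lin_onZ (a j) lg)).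
have [i [j [ij e_ij]]] : exists i j : 'I_h.+1, (i < j)%N /\ idx i = idx j.
  have /injectivePn[x [y xy fxy]] : ~~ injectiveb idx.
    apply/negP => /injectiveP/leq_card; by rewrite !card_ord ltnn.
  have [lt|lt|/val_inj e'] := ltngtP x y; [by exists x, y|by exists y, x|].
  by rewrite e' eqxx in xy.
(* The factor between the prefixes i < j; as a nonempty product it lies in [mx]. *)
pose b : R := \prod_(x <- drop i (take j s)) x.
have ajE : a j = b * a i.
  rewrite mulrC /a /b -big_cat /=.
  by rewrite -[in take i s](@take_takel _ i j) ?(ltnW ij) // cat_take_drop.
have js : (j <= size s)%N by rewrite sh -ltnS ltn_ord.
have bm : b \in mx.
  rewrite /b; case E : (drop i (take j s)) => [|x l].
    have := congr1 size E; rewrite size_drop size_takel //= => /eqP.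
    by rewrite subn_eq0 leqNgt ij.
  rewrite big_cons mulrC idealr_mull // sm //.
  have : x \in drop i (take j s) by rewrite E mem_head.
  by move=> /mem_drop/mem_take.
have iso : isomorphic (pushout (lin_onZ (a i) lg))
    (pushout (lin_onZ b (lin_onZ (a i) lg))).
  have -> : pushout (lin_onZ b (lin_onZ (a i) lg)) = pushout (lin_onZ (a j) lg).
    by apply: pushout_eq; apply: funext => v; rewrite ajE scalerA.
  apply: isomorphic_trans (idxP i) _; rewrite e_ij.
  exact/isomorphic_sym/idxP.
have [G GE] := ext_of_iso nR lR pFs fN lN bm iso.
have aic : a i *: c \in coboundary1 P N.
  by apply: (@coboundary_of_ext _ G) => u pu; rewrite GE.
have -> : \prod_(x <- s) x = (\prod_(x <- drop i s) x) * a i.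
  by rewrite -[in LHS](cat_take_drop i s) big_cat /= mulrC.
by rewrite -scalerA rpredZ.
Qed.

End Resolution.

Theorem theorem1 (R : comNzRingType) (mx : idealr R)
    (M N : lmodType R) (m n h : nat) :
  noetherian R -> local_ring mx ->
  is_MCM mx M -> is_MCM mx N ->
  has_multiplicity mx M m -> has_multiplicity mx N n ->
  num_iso_classes
    (fun L : lmodType R => is_MCM mx L /\ has_multiplicity mx L (m + n)%N) h ->
  forall P : proj_resolution M,
    (forall r : R, r \in ideal_pow mx h -> forall e : Ext1 P N, r *: e = 0) /\
    finite_length (Ext1 P N).
Proof.
move=> /noetherian_noeth_mod nR lR cM cN mM mN [K [_ _ hK]] P.
have [[q [x xP]] _] := cM; have [fgN _] := cN; have /fin_genP fN := fgN.
have [fgM _] := cM.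
have pFs y : exists v, lincomb x v = y.
  have [c ->] := xP y; exists (\row_j c j); rewrite mklinE.
  by apply: eq_bigr => j _; rewrite mxE.
have [phi phiE] := rV_lift (lincomb x) (@res_aug_surj _ _ P).
(* The implication is inside the existential so that [w] can be chosen on all of R^q, with 0 off the
   kernel. *)
have hw (v : 'rV[R]_q) : exists z, lincomb x v = 0 -> res_diff P 0 z = phi v.
  have [v0|v0] := pselect (lincomb x v = 0); last by exists 0.
  by have [|z ->] := (@res_exact0 _ _ P (phi v)).1; [rewrite phiE|exists z].
have [w wE] := choice hw.
have lN k : finite_length (quotm (powm mx k (fullm N)) : lmodType R).
  by have [d [l [_ hl _]]] := mN; exists (l k); apply/has_length_powm.
have killed : forall r : R, r \in ideal_pow mx h -> forall e : Ext1 P N, r *: e = 0.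
  apply: (Ext1_killed pFs phiE wE nR lR fN lN (K := K)) => g lg.
  apply: hK; have [p ex] := pushout_short_exact lg pFs; split.
    exact: (is_MCM_exact nR lR ex).
  exact: (has_multiplicity_exact nR ex).
split=> //; apply: (finite_length_killed nR lR _ killed).
exact: (fg_Ext1 pFs phiE wE nR fN).
Qed.
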